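(* Let $m\in\mathbb{N}$, let $\gamma$ be the standard Gaussian measure on $\mathbb{R}^m$, and let $g\in L^2(\mathbb{R}^m,\gamma)$ be a convex function. Then the minimizer of \[ \min_{u\in H^1_\gamma(\mathbb{R}^m)} \int_{\mathbb{R}^m}\frac{|\nabla u|^2}{2}\,d\gamma+\frac12\int_{\mathbb{R}^m}|u-g|^2\,d\gamma \] is convex.
   Context: $\gamma$ has density $(2\pi)^{-m/2}e^{-|x|^2/2}$. $H^1_\gamma(\mathbb{R}^m)$ denotes the Gaussian Sobolev space, i.e. the domain of the closure in $L^2(\mathbb{R}^m,\gamma)$ of the gradient operator defined on smooth functions. *)

(* Defs.v *)
From HB Require Import structures.
From mathcomp Require Import all_boot all_order all_algebra.
From mathcomp Require Import all_classical all_reals all_analysis.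
Set Implicit Arguments. Unset Strict Implicit. Unset Printing Implicit Defensive.
Import Order.TTheory GRing.Theory Num.Theory.
Import numFieldNormedType.Exports.
Local Open Scope classical_set_scope.
Local Open Scope ring_scope.

(** Integral against the standard Gaussian measure gamma_m on R^m of a
    nonnegative extended-real function, defined as the iterated integral
    against the 1-dimensional standard normal law N(0,1)
    (gamma_m = N(0,1)^{(x) m}; by Tonelli this is the product-measure integral
    for nonnegative Borel functions). *)
Fixpoint gauss_int {R : realType} (m : nat) : ('rV[R]_m -> \bar R) -> \bar R :=
  match m with
  | 0%N => fun f => f 0
  | m'.+1 => fun f =>
      (\int[normal_prob (0:R) 1]_(x in [set: R])
         gauss_int (fun y : 'rV[R]_m' => f (row_mx (const_mx x : 'rV[R]_1) y)))%E
  end.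

(** Borel measurability on R^m: measurability w.r.t. the product sigma-algebra
    (generated by the coordinates) on m.-tuple R. *)
Definition rV_measurable {R : realType} (m : nat) (f : 'rV[R]_m -> R) : Prop :=
  measurable_fun [set: m.-tuple R] (fun t => f (\row_i tnth t i)).

Definition L2g {R : realType} (m : nat) (f : 'rV[R]_m -> R) : Prop :=
  rV_measurable f /\ (gauss_int (fun x => ((f x) ^+ 2)%:E) < +oo)%E.

Definition L2gV {R : realType} (m : nat) (F : 'rV[R]_m -> 'rV[R]_m) : Prop :=
  forall i : 'I_m, L2g (fun x => F x 0 i).

Definition dist2 {R : realType} (m : nat) (f h : 'rV[R]_m -> R) : \bar R :=
  gauss_int (fun x => ((f x - h x) ^+ 2)%:E).
Definition dist2V {R : realType} (m : nat) (F H : 'rV[R]_m -> 'rV[R]_m) : \bar R :=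
  gauss_int (fun x => (\sum_(i < m) (F x 0 i - H x 0 i) ^+ 2)%:E).

Definition iter_deriv {R : realType} (m : nat) (vs : seq 'rV[R]_m)
    (f : 'rV[R]_m -> R) : 'rV[R]_m -> R :=
  foldr (fun v g => 'D_v g) f vs.

Definition smooth {R : realType} (m : nat) (f : 'rV[R]_m -> R) : Prop :=
  forall vs : seq 'rV[R]_m,
    continuous (iter_deriv vs f) /\
    forall (v x : 'rV[R]_m), derivable (iter_deriv vs f) x v.

Definition grad {R : realType} (m : nat) (f : 'rV[R]_m -> R) : 'rV[R]_m -> 'rV[R]_m :=
  fun x => \row_(i < m) 'D_(delta_mx 0 i : 'rV[R]_m) f x.

(** H^1_gamma: the graph of the closure in L^2(gamma) of the gradient defined on
    smooth functions. [H1g u G] means u is in the domain of the closure and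
    G is (a representative of) its closed gradient. *)
Definition H1g {R : realType} (m : nat) (u : 'rV[R]_m -> R)
    (G : 'rV[R]_m -> 'rV[R]_m) : Prop :=
  L2g u /\ L2gV G /\
  exists phi : nat -> 'rV[R]_m -> R,
    (forall n, smooth (phi n) /\ L2g (phi n) /\ L2gV (grad (phi n))) /\
    ((fun n => dist2 (phi n) u) @ \oo --> 0%E) /\
    ((fun n => dist2V (grad (phi n)) G) @ \oo --> 0%E).

Definition energy {R : realType} (m : nat) (g u : 'rV[R]_m -> R)
    (G : 'rV[R]_m -> 'rV[R]_m) : \bar R :=
  (gauss_int (fun x => ((\sum_(i < m) (G x 0 i) ^+ 2) / 2)%:E)
   + gauss_int (fun x => ((u x - g x) ^+ 2 / 2)%:E))%E.

Definition convex_fun {R : realType} (m : nat) (f : 'rV[R]_m -> R) : Prop :=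
  forall (x y : 'rV[R]_m) (t : R), 0 <= t <= 1 ->
    f (t *: x + (1 - t) *: y) <= t * f x + (1 - t) * f y.

Definition ae_eq_gauss {R : realType} (m : nat) (f h : 'rV[R]_m -> R) : Prop :=
  gauss_int (fun x => (\1_[set y | f y != h y] x : R)%:E) = 0%E.

(* Main.v *)
(** The Euler-Lagrange equation of the functional is [u - L u = g], where
    [L = Delta - x . nabla] is the Ornstein-Uhlenbeck operator, so that
    [u = (1 - L)^-1 g = \int_0^1 P_s g ds] with Mehler's kernel
    [P_s g x = \int g (s x + sqrt (1 - s^2) y) dgamma(y)], and this formula visibly
    preserves convexity.  To identify [u] with [\int_0^1 P_s g ds] almost everywhere,
    test the weak equation with the waves [E_s x = exp (s^2 |a|^2 / 2) cos (s a . x + b)]: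
    they satisfy [- L E_s = s dE_s/ds], so integrating the weak equation
    [<u, E_s + s dE_s/ds> = <g, E_s>] in [s] gives [<u, E_1> = \int_0^1 <g, E_s> ds],
    and [P_s E_1 = E_s] together with the symmetry of [P_s] turns the right-hand side
    into the pairing of [\int_0^1 P_s g ds] with [E_1].  Waves separate integrable
    functions.  Finally [\int_0^1 P_s g ds] converges at every point, and not only
    almost everywhere, because the domain of finiteness of a convex function is convex,
    and a convex set of full measure is everything. *)
Require Import Defs.
From HB Require Import structures.
From mathcomp Require Import all_boot all_order all_algebra.
From mathcomp Require Import all_classical all_reals all_analysis.
From mathcomp Require Import measurable_realfun.
From mathcomp Require Import ring lra.
Import Order.TTheory GRing.Theory Num.Theory.
Import numFieldNormedType.Exports.
Local Open Scope classical_set_scope.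
Local Open Scope ring_scope.

Set Implicit Arguments.
Unset Strict Implicit.
Unset Printing Implicit Defensive.

(** * Real-valued integrals *)

(** The formula for [u] is the Laplace transform of the Ornstein-Uhlenbeck semigroup,
    [(1 - L)^-1 = \int_0^oo e^-t e^{tL} dt], after the substitution [s = e^-t]. The minimizer is
    known only through its first variation, so test functions are wanted that stay in the domain of
    the gradient, on which [L] and [P_s] are explicit, and that determine an integrable function.
    Waves do all three: differentiation only shifts their phase, and products of waves are sums of
    waves, so that bounded limits of their combinations reach indicators of boxes. The injectivity
    of the Fourier transform obtained in this way serves twice: it separates [u] from the resolvent
    of [g], and it recognizes Gaussian laws. Rotation and reflection invariance, the symmetry of
    [P_s] and the freedom to single out any coordinate all become comparisons of characteristic
    functions. The variables [s] and [y] are treated as one variable of a product probability, so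
    that the resolvent is a single integral, convex because its integrand is, once integrability is
    known at every point. *)

Notation Rintegrable mu f := ((mu : set _ -> \bar _).-integrable setT (EFin \o f)).

Section real_integrals.
Context d (T : measurableType d) (R : realType).

Lemma bounded_Rintegrable (mu : {finite_measure set T -> \bar R}) (f : T -> R) M :
  measurable_fun setT f -> (forall t, `|f t| <= M) -> Rintegrable mu f.
Proof.
move=> mf bf; apply: measurable_bounded_integrable => //.
  exact: fin_num_fun_lty.
exists M; split; first by rewrite num_real.
by move=> x Mx t _; apply: le_trans (bf t) (ltW Mx).
Qed.

Lemma Rintegrable_le (mu : {measure set T -> \bar R}) (f g : T -> R) :
  measurable_fun setT f -> Rintegrable mu g -> (forall t, `|f t| <= g t) ->
  Rintegrable mu f.
Proof.
move=> mf ig fg; apply: le_integrable ig => //; first exact/measurable_EFinP.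
move=> t _ /=; rewrite lee_fin; apply: le_trans (fg t) _; exact: ler_norm.
Qed.

Lemma Rintegrable_measurable (mu : {measure set T -> \bar R}) (f : T -> R) :
  Rintegrable mu f -> measurable_fun setT f.
Proof. by move=> /measurable_int/measurable_EFinP. Qed.

Lemma RintegrableD (mu : {measure set T -> \bar R}) (f g : T -> R) :
  Rintegrable mu f -> Rintegrable mu g -> Rintegrable mu (fun t => f t + g t).
Proof. by move=> fi gi; exact: (@integrableD _ _ _ mu setT measurableT (EFin \o f) (EFin \o g)). Qed.

Lemma RintegrableB (mu : {measure set T -> \bar R}) (f g : T -> R) :
  Rintegrable mu f -> Rintegrable mu g -> Rintegrable mu (fun t => f t - g t).
Proof. by move=> fi gi; exact: (@integrableB _ _ _ mu setT measurableT (EFin \o f) (EFin \o g)). Qed.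

Lemma RintegrableZl (mu : {measure set T -> \bar R}) k (f : T -> R) :
  Rintegrable mu f -> Rintegrable mu (fun t => k * f t).
Proof. by move=> fi; exact: (@integrableZl _ _ _ mu setT measurableT k (EFin \o f)). Qed.

Lemma Rintegrable_bddM (mu : {measure set T -> \bar R}) (f g : T -> R) M :
  Rintegrable mu f -> measurable_fun setT g -> (forall t, `|g t| <= M) ->
  Rintegrable mu (fun t => f t * g t).
Proof.
move=> fi mg bg; have mf := Rintegrable_measurable fi.
have fM : Rintegrable mu (fun t => M * `|f t|).
  by apply: RintegrableZl; exact: integrable_norm.
apply: Rintegrable_le fM _; first exact: measurable_funM.
by move=> t; rewrite normrM mulrC ler_wpM2r.
Qed.

Lemma Rintegral_prob_cst (P : probability T R) (k : R) : \int[P]_t k = k.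
Proof.
have PT : fine (P setT) = 1 by rewrite probability_setT.
by rewrite Rintegral_cst// PT mulr1.
Qed.

Lemma Rintegral_dominated (mu : {measure set T -> \bar R}) (f_ : nat -> T -> R)
    (f g : T -> R) :
  (forall n, measurable_fun setT (f_ n)) -> measurable_fun setT f ->
  (forall t, f_ ^~ t @ \oo --> f t) -> Rintegrable mu g ->
  (forall n t, `|f_ n t| <= g t) ->
  (fun n => \int[mu]_t f_ n t) @ \oo --> \int[mu]_t f t.
Proof.
move=> mf_ mf ff ig fg.
have []// := @dominated_convergence _ _ _ mu setT measurableT
  (fun n => EFin \o f_ n) (EFin \o f) (EFin \o g).
- by move=> n; apply/measurable_EFinP.
- exact/measurable_EFinP.
- apply: aeW => t _; apply: cvg_EFin; [exact: nearW|exact: ff].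
- by apply: aeW => t n _ /=; rewrite lee_fin.
move=> iF _ cF; rewrite /Rintegral.
apply: fine_cvg; rewrite fineK//; last exact: integrable_fin_num.
Qed.

End real_integrals.

(** * Polynomials converging to a step function *)

Section power_limits.
Variable R : realType.
Implicit Types x y : R.

Lemma bernoulli_ineq y n : -1 <= y -> 1 + n%:R * y <= (1 + y) ^+ n.
Proof.
move=> y1; elim: n => [|n IH]; first by rewrite expr0 mul0r addr0.
have y0 : 0 <= 1 + y by lra.
rewrite exprSr; apply: le_trans (ler_wpM2r y0 IH).
have : 0 <= n%:R * y ^+ 2 by rewrite mulr_ge0// sqr_ge0.
rewrite -natr1; lra.
Qed.

(** The bound [y <= z ^+ 2] with [z = (1 + y) / 2 < 1] provides two factors: one is spent on
    [n z^n <= 1 + z + ... <= 1 / (1 - z)], the other tends to 0. *)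
Lemma cvg_natM_expr y : 0 <= y < 1 -> (fun n => n%:R * y ^+ n) @ \oo --> (0 : R).
Proof.
move=> /andP[y0 y1].
pose z := (1 + y) / 2.
have z0 : 0 <= z < 1 by rewrite /z; lra.
have yz : y <= z ^+ 2 by have := sqr_ge0 (1 - y); rewrite /z expr_div_n; lra.
have bnd n : n%:R * z ^+ n <= (1 - z)^-1.
  rewrite -[leRHS]mul1r ler_pdivlMr; last by lra.
  have : \sum_(i < n) z ^+ n <= \sum_(i < n) z ^+ i.
    by apply: ler_sum => i _; apply: ler_wiXn2l; [lra|lra|exact: ltnW].
  rewrite sumr_const card_ord -[_ *+ n]mulr_natl => h.
  have := subrX1 z n => e.
  have z1 : 0 <= 1 - z by lra.
  apply: le_trans (ler_wpM2r z1 h) _.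
  have : 0 <= z ^+ n by apply: exprn_ge0; lra.
  lra.
apply: (@squeeze_cvgr _ _ _ _ (fun=> 0) (fun n => geometric (1 - z)^-1 z n)).
- apply: nearW => n; apply/andP; split; first by rewrite mulr_ge0// exprn_ge0.
  have hn : y ^+ n <= z ^+ n * z ^+ n.
    by rewrite -exprMn -expr2; apply: lerXn2r; rewrite ?nnegrE// sqr_ge0.
  apply: le_trans (ler_wpM2l (ler0n _ n) hn) _.
  rewrite mulrA /geometric/=; apply: ler_wpM2r => //; apply: exprn_ge0; lra.
- exact: cvg_cst.
- by apply: cvg_geometric; rewrite ger0_norm; lra.
Qed.

(** The exponent is [n * 2 ^ n] rather than [2 ^ n] because of the threshold itself: at [x = 1 / 2]
    the smaller exponent would give the limit [1 / e], and the extra factor [n] sends it to 0. *)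
Definition bump_pow n x := (1 - x ^+ n) ^+ (n * 2 ^ n).

Lemma bump_pow_bounds n x : 0 <= x <= 1 -> 0 <= bump_pow n x <= 1.
Proof.
move=> /andP[x0 x1]; rewrite /bump_pow.
have h : 0 <= x ^+ n <= 1 by rewrite exprn_ge0//= exprn_ile1.
by rewrite exprn_ge0 ?exprn_ile1//; lra.
Qed.

(** Bernoulli's inequality serves on both sides of the threshold. Below, it gives the lower bound
    [1 - n (2 x)^n]. Above, it gives [(1 + x^n)^N >= n + 1] for the exponent [N = n 2^n], while the
    product of this power with [bump_pow n x] is a power of [1 - x^(2 n)], hence at most 1. *)
Lemma cvg_bump_pow x : 0 <= x <= 1 ->
  (fun n => bump_pow n x) @ \oo --> ((x < 2^-1)%R%:R : R).
Proof.
move=> x01; have /andP[x0 x1] := x01.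
have xn n : 0 <= x ^+ n <= 1 by rewrite exprn_ge0//= exprn_ile1.
have NE n : (n * 2 ^ n)%:R * x ^+ n = n%:R * (2 * x) ^+ n.
  by rewrite natrM natrX exprMn mulrA.
have [xh|xh] /= := ltP x 2^-1.
- apply: (@squeeze_cvgr _ _ _ _ (fun n => 1 - n%:R * (2 * x) ^+ n) (fun=> 1)).
  + apply: nearW => n; apply/andP; split; last by case/andP: (bump_pow_bounds n x01).
    rewrite -NE -mulrN; apply: bernoulli_ineq; have := xn n; lra.
  + rewrite -[X in _ --> X]subr0; apply: cvgB; first exact: cvg_cst.
    apply: cvg_natM_expr; lra.
  + exact: cvg_cst.
- apply: (@squeeze_cvgr _ _ _ _ (fun=> 0) (fun n => harmonic n)).
  + apply: nearW => n; have /andP[b0 b1] := bump_pow_bounds n x01.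
    rewrite b0 /harmonic/= -[leRHS]mul1r ler_pdivlMr ?ltr0n//.
    have h1 : n.+1%:R <= (1 + x ^+ n) ^+ (n * 2 ^ n).
      apply: le_trans (bernoulli_ineq _ _); last by have := xn n; lra.
      rewrite NE -natr1 addrC lerD2l ler_peMr// exprn_ege1//; lra.
    apply: le_trans (ler_wpM2l b0 h1) _.
    rewrite /bump_pow -exprMn; have := xn n.
    move: (x ^+ n) => w w01; apply: exprn_ile1; nra.
  + exact: cvg_cst.
  + exact: cvg_harmonic.
Qed.

End power_limits.

(** * Injectivity of the Fourier transform of finite measures *)

Section fourier.
Context d (T : measurableType d) (R : realType).
Variables (mu nu : {finite_measure set T -> \bar R}).
Variables (n : nat) (X : 'I_n -> T -> R).
Hypothesis mX : forall i, measurable_fun setT (X i).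

Definition osc (a : 'I_n -> R) (b : R) (t : T) : R := cos (\sum_i a i * X i t + b).

Lemma measurable_osc a b : measurable_fun setT (osc a b).
Proof.
apply: measurableT_comp; first by apply: continuous_measurable_fun; exact: continuous_cos.
apply: measurable_funD => //; apply: measurable_sum => i.
exact: measurable_funM.
Qed.

Lemma osc_le1 a b t : `|osc a b t| <= 1.
Proof. by rewrite ler_norml cos_geN1 cos_le1. Qed.

Definition balanced (f : T -> R) :=
  [/\ measurable_fun setT f, exists M, forall t, `|f t| <= M &
   forall a b, \int[mu]_t (f t * osc a b t) = \int[nu]_t (f t * osc a b t)].

(** Being balanced is not visibly stable under products, so multipliers are studied instead: they
    form an algebra that is stable under bounded pointwise limits. *)
Definition balancing (f : T -> R) :=
  forall p, balanced p -> balanced (fun t => p t * f t).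

Lemma balanced_osc_integrable (la : {finite_measure set T -> \bar R}) f a b :
  balanced f -> Rintegrable la (fun t => f t * osc a b t).
Proof.
move=> [mf [M fM] _]; apply: Rintegrable_bddM (measurable_osc a b) (osc_le1 a b).
exact: bounded_Rintegrable fM.
Qed.

Lemma balancedD f g : balanced f -> balanced g -> balanced (fun t => f t + g t).
Proof.
move=> bf bg; have [mf [M fM] ef] := bf; have [mg [N gN] eg] := bg; split.
- exact: measurable_funD.
- by exists (M + N) => t; apply: le_trans (ler_normD _ _) (lerD (fM t) (gN t)).
- move=> a b.
  have D (la : {finite_measure set T -> \bar R}) :
      \int[la]_t ((f t + g t) * osc a b t) =
      \int[la]_t (f t * osc a b t) + \int[la]_t (g t * osc a b t).
    under eq_Rintegral do rewrite mulrDl.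
    by rewrite RintegralD//; exact: balanced_osc_integrable.
  by rewrite !D ef eg.
Qed.

Lemma balancedZ k f : balanced f -> balanced (fun t => k * f t).
Proof.
move=> bf; have [mf [M fM] ef] := bf; split.
- exact: measurable_funM.
- by exists (`|k| * M) => t; rewrite normrM ler_wpM2l.
- move=> a b.
  have D (la : {finite_measure set T -> \bar R}) :
      \int[la]_t (k * f t * osc a b t) = k * \int[la]_t (f t * osc a b t).
    under eq_Rintegral do rewrite -mulrA.
    by rewrite RintegralZl//; exact: balanced_osc_integrable.
  by rewrite !D ef.
Qed.

Lemma balancing_cst k : balancing (fun=> k).
Proof.
move=> f /(balancedZ k); rewrite (_ : (fun t => k * f t) = (fun t => f t * k))//.
by apply/funext => t; rewrite mulrC.
Qed.

Lemma balancingD f g : balancing f -> balancing g -> balancing (fun t => f t + g t).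
Proof.
move=> bf bg p bp; rewrite (_ : (fun t => _) = (fun t => p t * f t + p t * g t)).
  by apply: balancedD; [exact: bf|exact: bg].
by apply/funext => t; rewrite mulrDr.
Qed.

Lemma balancingM f g : balancing f -> balancing g -> balancing (fun t => f t * g t).
Proof.
move=> bf bg p bp; rewrite (_ : (fun t => _) = (fun t => p t * f t * g t)).
  by apply/bg/bf.
by apply/funext => t; rewrite mulrA.
Qed.

Lemma balancingX f k : balancing f -> balancing (fun t => f t ^+ k).
Proof.
move=> bf; elim: k => [|k IH].
  by under eq_fun do rewrite expr0; exact: balancing_cst.
by under eq_fun do rewrite exprS; exact: balancingM.
Qed.

(* Product-to-sum: multiplication by one wave permutes the family of waves. *)
Lemma balancing_osc a b : balancing (osc a b).
Proof.
move=> f bf; have [mf [M fM] ef] := bf; split.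
- by apply: measurable_funM => //; exact: measurable_osc.
- exists M => t; rewrite normrM -[leRHS]mulr1.
  by apply: ler_pM => //; exact: osc_le1.
- move=> a' b'.
  have D (la : {finite_measure set T -> \bar R}) :
      \int[la]_t (f t * osc a b t * osc a' b' t) =
      2^-1 * \int[la]_t (f t * osc (a \+ a') (b + b') t) +
      2^-1 * \int[la]_t (f t * osc (a \- a') (b - b') t).
    rewrite -!RintegralZl//; try exact: balanced_osc_integrable.
    rewrite -RintegralD//; try by apply: RintegrableZl; exact: balanced_osc_integrable.
    apply: eq_Rintegral => t _; rewrite /osc.
    have -> : \sum_i (a \+ a') i * X i t + (b + b') =
        (\sum_i a i * X i t + b) + (\sum_i a' i * X i t + b').
      under eq_bigr do rewrite mulrDl.
      by rewrite big_split/=; ring.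
    have -> : \sum_i (a \- a') i * X i t + (b - b') =
        (\sum_i a i * X i t + b) - (\sum_i a' i * X i t + b').
      under eq_bigr do rewrite mulrBl.
      by rewrite sumrB/=; ring.
    move: (_ + b) (_ + b') => A B.
    by rewrite cosD cosB; field.
  by rewrite !D !ef.
Qed.

Lemma balancing_lim (f_ : nat -> T -> R) (f : T -> R) M :
  (forall k, balancing (f_ k)) ->
  (forall k, measurable_fun setT (f_ k)) -> measurable_fun setT f ->
  (forall k t, `|f_ k t| <= M) -> (forall t, `|f t| <= M) ->
  (forall t, f_ ^~ t @ \oo --> f t) -> balancing f.
Proof.
move=> bf_ mf_ mf f_M fM ff p bp; have [mp [N pN] _] := bp.
split.
- exact: measurable_funM.
- by exists (N * M) => t; rewrite normrM; exact: ler_pM.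
move=> a b.
have C (la : {finite_measure set T -> \bar R}) :
    (fun k => \int[la]_t (p t * f_ k t * osc a b t)) @ \oo -->
    \int[la]_t (p t * f t * osc a b t).
  apply: (Rintegral_dominated (g := fun=> N * M)).
  - move=> k; apply: measurable_funM; last exact: measurable_osc.
    exact: measurable_funM.
  - by apply: measurable_funM; [exact: measurable_funM|exact: measurable_osc].
  - move=> t; apply: cvgM; last exact: cvg_cst.
    by apply: cvgM; [exact: cvg_cst|exact: ff].
  - exact: finite_measure_integrable_cst.
  - move=> k t; rewrite normrM -[leRHS]mulr1; apply: ler_pM => //; last exact: osc_le1.
    by rewrite normrM; exact: ler_pM.
have E : (fun k => \int[mu]_t (p t * f_ k t * osc a b t)) =
         (fun k => \int[nu]_t (p t * f_ k t * osc a b t)).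
  by apply/funext => k; have [_ _ ->] := bf_ k p bp.
by apply: cvg_unique (C mu) _ => //; rewrite E; exact: C.
Qed.

Definition gt_ind (i : 'I_n) (c : R) (t : T) : R := (c < X i t)%R%:R.

Lemma measurable_ltr_ind (f : T -> R) (c : R) : measurable_fun setT f ->
  measurable_fun setT (fun t => (f t < c)%R%:R : R).
Proof.
move=> mf.
rewrite (_ : (fun t => _) = \1_(f @^-1` `]-oo, c[) :> (T -> R)).
  apply: measurable_indic; rewrite -[X in measurable X]setTI.
  by apply: mf => //; exact: measurable_itv.
by apply/funext => t; rewrite indicE; congr (nat_of_bool _)%:R; apply/idP/idP;
   rewrite inE/= in_itv.
Qed.

Lemma measurable_gt_ind i c : measurable_fun setT (gt_ind i c).
Proof.
rewrite (_ : gt_ind i c = (fun t => (- X i t < - c)%R%:R)).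
  by apply: measurable_ltr_ind; exact: measurableT_comp.
by apply/funext => t; rewrite /gt_ind ltrN2.
Qed.

(** The function [f = (1 - sin) / 2] takes values in [0, 1], is below 1/2 exactly where the sine is
    positive, and is affine in a wave, hence a multiplier. The polynomials [bump_pow k] of [f]
    converge boundedly to the indicator. *)
Lemma balancing_sin_gt0 i (a c : R) :
  balancing (fun t => (0 < sin (a * (X i t - c)))%R%:R : R).
Proof.
pose f t : R := (1 - sin (a * (X i t - c))) / 2.
have f01 t : 0 <= f t <= 1.
  by have := sin_le1 (a * (X i t - c)); have := sin_geN1 (a * (X i t - c)); rewrite /f; lra.
have mf : measurable_fun setT f.
  apply: measurable_funM => //; apply: measurable_funB => //.
  apply: measurableT_comp; first by apply: continuous_measurable_fun; exact: continuous_sin.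
  by apply: measurable_funM => //; exact: measurable_funB.
have bf : balancing f.
  rewrite (_ : f = (fun t => 2^-1 +
      (- 2^-1) * osc (fun j => a * (j == i)%:R) (- (a * c) - pi / 2) t)).
    apply: balancingD; first exact: balancing_cst.
    by apply: balancingM; [exact: balancing_cst|exact: balancing_osc].
  apply/funext => t; rewrite /f /osc (bigD1 i)//= eqxx mulr1 big1 ?addr0; last first.
    by move=> j /negbTE ->; rewrite mulr0 mul0r.
  by rewrite addrA cosBpihalf mulrBr; field.
rewrite (_ : (fun t => _) = (fun t => (f t < 2^-1)%R%:R)); last first.
  by apply/funext => t; congr (nat_of_bool _)%:R; rewrite /f; apply/idP/idP; lra.
apply: (@balancing_lim (fun k t => bump_pow k (f t)) _ 1).
- move=> k; apply: balancingX; apply: balancingD; first exact: balancing_cst.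
  under eq_fun do rewrite -mulN1r.
  by apply: balancingM; [exact: balancing_cst|exact: balancingX].
- move=> k; apply: measurable_funX; apply: measurable_funB => //.
  exact: measurable_funX.
- exact: measurable_ltr_ind.
- by move=> k t; have /andP[? ?] := bump_pow_bounds k (f01 t); rewrite ger0_norm.
- by move=> t; case: (f t < 2^-1)%R; rewrite ?normr1 ?normr0.
- by move=> t; exact: cvg_bump_pow.
Qed.

(** The argument eventually lies in [(- pi, pi)], where the sine has the sign of its argument: a
    square wave whose period grows to infinity becomes the indicator of a half-line. *)
Lemma cvg_sin_gt0 (y : R) :
  (fun k : nat => (0 < sin (k.+1%:R^-1 * y))%R%:R : R) @ \oo --> ((0 < y)%R%:R : R).
Proof.
have pi0 := pi_gt0 R.
have small : \forall k \near \oo, `|k.+1%:R^-1 * y| < pi.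
  near=> k; rewrite normrM ger0_norm ?invr_ge0// mulrC ltr_pdivrMr ?ltr0n//.
  rewrite -ltr_pdivrMl// mulrC.
  apply: (@lt_trans _ _ k%:R); last by rewrite ltr_nat.
  by near: k; exact: nbhs_infty_gtr.
apply: cvg_near_cst; near=> k; congr (nat_of_bool _)%:R.
have k0 : 0 < k.+1%:R^-1 :> R by rewrite invr_gt0.
have : `|k.+1%:R^-1 * y| < pi by near: k.
rewrite ltr_norml => /andP[s1 s2].
have [y0|y0|<-] := ltrgtP 0 y.
- by rewrite sin_gt0_pi// s2 mulr_gt0.
- have n0 : k.+1%:R^-1 * y < 0 by rewrite pmulr_rlt0.
  apply/negbTE; rewrite -leNgt -oppr_ge0 -sinN ltW// sin_gt0_pi//.
  by rewrite oppr_gt0 n0 ltrNl.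
- by rewrite mulr0 sin0 ltxx.
Unshelve. all: by end_near. Qed.

Lemma balancing_gt_ind i c : balancing (gt_ind i c).
Proof.
apply: (@balancing_lim
    (fun k t => (0 < sin (k.+1%:R^-1 * (X i t - c)))%R%:R) _ 1).
- by move=> k; exact: balancing_sin_gt0.
- move=> k; rewrite (_ : (fun t => _) =
     (fun t => (- sin (k.+1%:R^-1 * (X i t - c)) < 0)%R%:R)); last first.
    by apply/funext => t; rewrite oppr_lt0.
  apply: measurable_ltr_ind; apply: measurableT_comp => //.
  apply: measurableT_comp; first by apply: continuous_measurable_fun; exact: continuous_sin.
  by apply: measurable_funM => //; exact: measurable_funB.
- exact: measurable_gt_ind.
- by move=> k t; case: (0 < _)%R; rewrite ?normr1 ?normr0.
- by move=> t; rewrite /gt_ind; case: (_ < _)%R; rewrite ?normr1 ?normr0.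
- by move=> t; rewrite /gt_ind -subr_gt0; exact: cvg_sin_gt0.
Qed.

Definition upper_box (c : 'I_n -> R) : set T := [set t | forall i, c i < X i t].

Lemma upper_box_indic c t : \1_(upper_box c) t = \prod_i gt_ind i (c i) t :> R.
Proof.
rewrite indicE; have [h|h] := boolP (t \in upper_box c).
  rewrite big1// => i _; rewrite /gt_ind.
  by move: h; rewrite inE => /(_ i) ->.
suff [i hi] : exists i, ~~ (c i < X i t).
  by rewrite (bigD1 i)//= /gt_ind (negbTE hi) mul0r.
apply/existsP; apply: contraNT h; rewrite negb_exists => /forallP h.
by rewrite inE => i; have := h i; rewrite negbK.
Qed.

Lemma measurable_upper_box c : measurable (upper_box c).
Proof.
rewrite (_ : upper_box c = \bigcap_(i : 'I_n) (X i @^-1` `]c i, +oo[)).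
  apply: fin_bigcap_measurable => // i _; rewrite -[X in measurable X]setTI.
  by apply: mX => //; exact: measurable_itv.
apply/seteqP; split => t /= h i => [_|]; first by rewrite /= in_itv/= h.
by have := h i I; rewrite /= in_itv/= andbT.
Qed.

Hypothesis eq_osc : forall a b, \int[mu]_t osc a b t = \int[nu]_t osc a b t.

(** The constant 1 is balanced by hypothesis, hence so is its product with the half-space
    indicators. The wave of zero frequency and zero phase is 1 and reads off the measure of the
    box. *)
Lemma eq_measure_upper_box c : mu (upper_box c) = nu (upper_box c).
Proof.
have b1 : balanced (fun=> 1).
  split => //; first by exists 1 => t; rewrite normr1.
  by move=> a b; under eq_Rintegral do rewrite mul1r; rewrite eq_osc;
     under [in RHS]eq_Rintegral do rewrite mul1r.
have bP s : balancing (fun t => \prod_(i <- s) gt_ind i (c i) t).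
  elim: s => [|i s IH].
    by under eq_fun do rewrite big_nil; exact: balancing_cst.
  by under eq_fun do rewrite big_cons; apply: balancingM => //; exact: balancing_gt_ind.
have [_ _ /(_ (fun=> 0) 0)] := bP (index_enum _) _ b1.
have E (la : {finite_measure set T -> \bar R}) :
    \int[la]_t (1 * \prod_i gt_ind i (c i) t * osc (fun=> 0) 0 t) =
    fine (la (upper_box c)).
  have -> : (fun t => 1 * \prod_i gt_ind i (c i) t * osc (fun=> 0) 0 t) =
      \1_(upper_box c).
    apply/funext => t; rewrite upper_box_indic /osc.
    have -> : \sum_i (0 : R) * X i t = 0 by apply: big1 => i _; rewrite mul0r.
    by rewrite addr0 cos0 mul1r mulr1.
  by rewrite /Rintegral integral_indic ?setIT//; exact: measurable_upper_box.
rewrite !E => h; rewrite -[LHS]fineK ?h ?fineK//; apply: fin_num_measure; exact: measurable_upper_box.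
Qed.

End fourier.

Section tuple_fourier.
Variables (R : realType) (n : nat).

Let X (i : 'I_n) (t : n.-tuple R) : R := tnth t i.
Let G := range (upper_box X).

(** A half-space [c < t_i] is the union over [k] of the boxes whose other corners are [- k], so
    coordinates are measurable for the sigma-algebra generated by boxes. *)
Let G_gen : @measurable _ (n.-tuple R) = <<s G >>.
Proof.
apply/seteqP; split; last first.
  apply: smallest_sub; first exact: sigma_algebra_measurable.
  by move=> _ [c _ <-]; apply: measurable_upper_box => i; exact: measurable_tnth.
suff mid : @measurable_fun _ _ (g_sigma_algebraType G) (n.-tuple R) setT id.
  by move=> A /(mid measurableT); rewrite setTI.
apply/measurable_fun_tnthP => i.
apply: (measurability (@RGenOInfty.G R)); first exact: RGenOInfty.measurableE.
move=> _ [_ [c ->] <-]; rewrite setTI.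
rewrite (_ : _ @^-1` _ =
    \bigcup_k upper_box X (fun j => if j == i then c else - k%:R)).
  by apply: bigcup_measurable => k _; apply: sub_sigma_algebra; eexists.
apply/seteqP; split => t /=; rewrite in_itv/= andbT; last first.
  by move=> [k _ /(_ i)]; rewrite eqxx.
move=> ct; pose M := \sum_j `|tnth t j|.
exists (Num.truncn M).+1 => // j; case: eqP => [->//|_].
rewrite ltrNl; apply: (@le_lt_trans _ _ M); last exact: truncnS_gt.
apply: le_trans (ler_norm _) _; rewrite normrN /M (bigD1 j)//= lerDl.
exact: sumr_ge0.
Qed.

(** Boxes form a generating pi-system: two of them meet in the box of the coordinatewise maxima, and
    the boxes with all corners at [- k] exhaust the space. *)
Lemma eq_measure_tuple (mu nu : {finite_measure set (n.-tuple R) -> \bar R}) :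
  (forall a b, \int[mu]_t osc X a b t = \int[nu]_t osc X a b t) ->
  forall A, measurable A -> mu A = nu A.
Proof.
move=> eq_osc A mA.
have mX i : measurable_fun setT (X i) by exact: measurable_tnth.
apply: (measure_unique G (fun k => upper_box X (fun=> - k%:R))) => //.
- move=> _ _ [c _ <-] [c' _ <-]; exists (fun i => Num.max (c i) (c' i)) => //.
  apply/seteqP; split => t /=.
    by move=> h; split => i; have := h i; rewrite gt_max => /andP[].
  by move=> [h h'] i; rewrite gt_max h h'.
- by move=> k; eexists.
- rewrite -subTset => t _; pose M := \sum_j `|tnth t j|.
  exists (Num.truncn M).+1 => // j.
  rewrite ltrNl; apply: (@le_lt_trans _ _ M); last exact: truncnS_gt.
  apply: le_trans (ler_norm _) _; rewrite normrN /M (bigD1 j)//= lerDl.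
  exact: sumr_ge0.
- by move=> _ [c _ <-]; exact: eq_measure_upper_box.
- by move=> k; rewrite -ge0_fin_numE//; apply: fin_num_measure;
    exact: measurable_upper_box.
Qed.

End tuple_fourier.

(** * The one-dimensional Gaussian measure *)

Section normal_density_integral.
Variable R : realType.
Local Notation N := (normal_prob (0 : R) 1).
Local Notation leb := (@lebesgue_measure R).
Local Notation rho := (normal_pdf (0 : R) 1).

(** The Radon-Nikodym derivative of the normal law has the same integral as [rho] over every
    measurable set, so the two agree almost everywhere, and change of variables for the derivative
    becomes the formula with [rho]. *)
Lemma ge0_integral_normal (f : R -> \bar R) : measurable_fun setT f ->
  (forall x, 0 <= f x)%E ->
  (\int[N]_x f x = \int[leb]_x (f x * (rho x)%:E))%E.
Proof.
move=> mf f0; have dom := @normal_prob_dominates R 0 1.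
rewrite -(@Radon_Nikodym_SigmaFinite.change_of_variables _ _ _ N leb dom f setT f0)//.
have mr : measurable_fun setT (Radon_Nikodym_SigmaFinite.f N leb).
  by apply: measurable_int; apply: Radon_Nikodym_SigmaFinite.f_integrable.
have mrho : measurable_fun setT (EFin \o rho).
  by apply/measurable_EFinP; exact: measurable_normal_pdf.
have ae : ae_eq leb setT (Radon_Nikodym_SigmaFinite.f N leb) (EFin \o rho).
  apply: integral_ae_eq => //.
    exact: Radon_Nikodym_SigmaFinite.f_integrable.
  by move=> A _ mA; rewrite -Radon_Nikodym_SigmaFinite.f_integral.
apply: ae_eq_integral => //; try exact: emeasurable_funM.
by apply: filterS ae => x /= + _ => ->.
Qed.

Lemma integral_normal (f : R -> R) : measurable_fun setT f ->
  \int[N]_x f x = \int[leb]_x (f x * rho x).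
Proof.
move=> mf; have r0 x : 0 <= rho x by exact: normal_pdf_ge0.
rewrite /Rintegral; congr fine; rewrite integralE [RHS]integralE.
have mF : measurable_fun setT (EFin \o f) by exact/measurable_EFinP.
rewrite !ge0_integral_normal//; try exact: measurable_funepos; try exact: measurable_funeneg.
congr (_ - _)%E; apply: eq_integral => x _.
  by rewrite !funeposE /= maxe_pMl ?mul0e ?lee_fin.
by rewrite !funenegE /= maxe_pMl ?mul0e ?lee_fin// -EFinM mulNr.
Qed.

Lemma normal_Rintegrable (f : R -> R) : Rintegrable N f ->
  Rintegrable leb (fun x => f x * rho x).
Proof.
move=> fi; have mf := Rintegrable_measurable fi.
have mr := @measurable_normal_pdf R 0 1.
apply/integrableP; split; first by apply/measurable_EFinP; exact: measurable_funM.
move/integrableP : fi => [_]; rewrite ge0_integral_normal//; last first.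
  by apply: measurableT_comp => //; exact/measurable_EFinP.
apply: le_lt_trans; rewrite le_eqVlt; apply/orP; left; apply/eqP.
by apply: eq_integral => x _; rewrite /= normrM [X in _ * X]ger0_norm ?normal_pdf_ge0.
Qed.

Lemma is_derive_rho (x : R) : is_derive x 1 rho (- x * rho x).
Proof.
rewrite normal_pdfE ?oner_neq0//.
rewrite (_ : (fun y => _) =
    (normal_peak (1 : R) \*: (expR \o (fun y => - 2^-1 * (y * y)))) :> (R -> R)).
  have D : is_derive x 1 (fun y : R => - 2^-1 * (y * y)) (- x).
    by apply: is_derive_eq; rewrite /GRing.scale/=; field.
  have D2 := @is_derive1_comp _ expR _ x _ _ (is_derive_expR _) D.
  apply: is_derive_eq; rewrite /GRing.scale/= /normal_fun subr0 expr1n.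
  rewrite (_ : - x ^+ 2 / 2 = - 2^-1 * (x * x)); last by field.
  ring.
apply/funext => y; rewrite /normal_fun subr0 expr1n /=; congr (_ * expR _).
by field.
Qed.

Lemma Rintegral_FTC2 (f F : R -> R) (a b : R) : a < b ->
  (forall x : R, is_derive x 1 F (f x)) -> continuous f ->
  \int[leb]_(x in `[a, b]) f x = F b - F a.
Proof.
move=> ab dF cf; have cF : continuous F.
  by move=> x; apply/differentiable_continuous/derivable1_diffP; case: (dF x).
rewrite /Rintegral (@continuous_FTC2 _ f F)//.
- exact: continuous_subspaceT.
- split; first by move=> x _; case: (dF x).
  + exact/cvg_at_right_filter/cF.
  + exact/cvg_at_left_filter/cF.
- by move=> x _; rewrite derive1E; case: (dF x).
Qed.

(* Truncating with [1 - x^2/n^2] on [-n, n] kills the boundary terms. *)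
Lemma Rintegral_derive_eq0 (F f : R -> R) :
  (forall x : R, is_derive x 1 F (f x)) -> continuous f ->
  Rintegrable leb F -> Rintegrable leb f -> \int[leb]_x f x = 0.
Proof.
move=> dF cf iF if_.
pose k n : R := n.+1%:R.
have k0 n : 0 < k n by rewrite ltr0n.
pose chi n (x : R) : R := 1 - (k n ^- 2) * x ^+ 2.
pose dchi n (x : R) : R := - (k n ^- 2) * (2 * x).
pose h n x := chi n x * f x + dchi n x * F x.
have cF : continuous F.
  by move=> x; apply/differentiable_continuous/derivable1_diffP; case: (dF x).
have h0 n : \int[leb]_(x in `[- k n, k n]) h n x = 0.
  transitivity (chi n (k n) * F (k n) - chi n (- k n) * F (- k n)); last first.
    by rewrite /chi sqrrN mulVf ?expf_neq0 ?gt_eqF// subrr !mul0r subrr.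
  apply: (@Rintegral_FTC2 _ (fun x => chi n x * F x)).
  - by have := k0 n; lra.
  - move=> x.
    have D : is_derive x 1 (chi n) (dchi n x).
      rewrite /chi /dchi; apply: is_derive_eq; rewrite /GRing.scale/=; ring.
    apply: is_derive_eq; rewrite /h /GRing.scale/=; ring.
  - move=> x; apply: cvgD; apply: cvgM; [|exact: cf| |exact: cF].
    + apply: cvgB; first exact: cvg_cst.
      by apply: cvgM; [exact: cvg_cst|exact: exprn_continuous].
    + by apply: cvgM; [exact: cvg_cst|apply: cvgM; [exact: cvg_cst|exact: cvg_id]].
have mf : measurable_fun [set: R] f by exact: Rintegrable_measurable if_.
have mF : measurable_fun [set: R] F by exact: Rintegrable_measurable iF.
have mchi n : measurable_fun setT (chi n).
  by apply: measurable_funB => //; apply: measurable_funM => //; exact: measurable_funX.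
have mdchi n : measurable_fun setT (dchi n).
  by apply: measurable_funM => //; exact: measurable_funM.
pose g n := h n \_ `[- k n, k n].
have mg n : measurable_fun [set: R] (g n).
  apply: (measurable_restrictT (h n) _).1; first exact: measurable_itv.
  apply: measurable_funTS; rewrite /h.
  by apply: measurable_funD; exact: measurable_funM.
have g0 n : \int[leb]_x g n x = 0 by rewrite -Rintegral_mkcond.
have : (fun n => \int[leb]_x g n x) @ \oo --> \int[leb]_x f x.
  (* On [[- k, k]] the cutoff is at most 1, and its derivative [2 |x| / k^2] is at most 2 in
     absolute value because [|x| <= k <= k^2]; this uses [1 <= k], whence [k n] is [n.+1]. *)
  apply: (@Rintegral_dominated _ _ R leb g f (fun x => `|f x| + 2 * `|F x|)) => //.
  - move=> x.
    have near_in : \forall n \near \oo, g n x = h n x.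
      near=> n; rewrite /g patchE mem_set//= in_itv/= -ler_norml ltW//.
      apply: (@lt_trans _ _ n%:R); last by rewrite ltr_nat.
      by near: n; exact: nbhs_infty_gtr.
    have kk : (fun n => k n ^- 2) @ \oo --> (0 : R).
      rewrite (_ : (fun n => _) = (fun n => harmonic n * harmonic n)).
        rewrite -[X in _ --> X](mulr0 (0 : R)); apply: cvgM; exact: cvg_harmonic.
      by apply/funext => n; rewrite /harmonic/= /k expr2 invfM.
    suff hc : (fun n => h n x) @ \oo --> f x.
      by apply: cvg_trans hc; apply: near_eq_cvg; apply: filterS near_in => n ->.
    rewrite [X in _ --> X](_ : _ = (1 - 0 * x ^+ 2) * f x + - 0 * (2 * x) * F x); last by ring.
    apply: cvgD; (apply: cvgM; last exact: cvg_cst).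
    + by apply: cvgB; [exact: cvg_cst|apply: cvgM => //; exact: cvg_cst].
    + by apply: cvgM; [exact: cvgN|exact: cvg_cst].
  - apply: RintegrableD; first exact: integrable_norm.
    by apply: RintegrableZl; exact: integrable_norm.
  - move=> n x; rewrite /g patchE; case: ifPn => [|_]; last first.
      by rewrite normr0 addr_ge0// mulr_ge0.
    rewrite inE/= in_itv/= -ler_norml => xk.
    have q0 : 0 <= k n ^- 2 by rewrite invr_ge0 exprn_ge0// ltW.
    have x2 : k n ^- 2 * x ^+ 2 <= 1.
      rewrite mulrC ler_pdivrMr ?exprn_gt0// mul1r -[x ^+ 2]ger0_norm ?sqr_ge0//.
      by rewrite normrX lerXn2r// nnegrE// ltW.
    have kk : k n ^- 2 * `|x| <= 1.
      rewrite mulrC ler_pdivrMr ?exprn_gt0// mul1r; apply: le_trans xk _.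
      have k1 : 1 <= k n by rewrite /k ler1n.
      by rewrite expr2 ler_peMr ?(ltW (k0 n)).
    rewrite /h; apply: le_trans (ler_normD _ _) _; apply: lerD; rewrite normrM.
      rewrite -[leRHS]mul1r ler_wpM2r// /chi ger0_norm ?subr_ge0//.
      by rewrite gerBl mulr_ge0// sqr_ge0.
    rewrite ler_wpM2r// /dchi normrM normrN (ger0_norm q0) normrM ger0_norm// mulrCA.
    by rewrite -[leRHS]mulr1 ler_wpM2l.
under eq_fun do rewrite g0.
by move=> h1; apply/esym; apply: cvg_unique h1 => //; exact: cvg_cst.
Unshelve. all: by end_near. Qed.

(** Since [rho' = - x rho], the derivative of [f rho] is [(f' - x f) rho], and the integral of an
    integrable derivative of an integrable function vanishes. *)
Lemma normal_integration_by_parts (f f' : R -> R) :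
  (forall x : R, is_derive x 1 f (f' x)) -> continuous f' ->
  Rintegrable N f -> Rintegrable N f' -> Rintegrable N (fun x => x * f x) ->
  \int[N]_x f' x = \int[N]_x (x * f x).
Proof.
move=> df cf' fi f'i xfi; apply/eqP; rewrite -subr_eq0 -RintegralB//; apply/eqP.
have di : Rintegrable N (fun x => f' x - x * f x) by exact: RintegrableB.
have cf : continuous f.
  by move=> x; apply/differentiable_continuous/derivable1_diffP; case: (df x).
rewrite integral_normal; last exact: Rintegrable_measurable di.
apply: (@Rintegral_derive_eq0 (fun x => f x * rho x)).
- move=> x; have D := is_derive_rho x.
  apply: is_derive_eq; rewrite /GRing.scale/=; ring.
- move=> x; apply: cvgM; last by apply: continuous_normal_pdf; rewrite oner_neq0.
  by apply: cvgB; [exact: cf'|apply: cvgM; [exact: cvg_id|exact: cf]].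
- exact: normal_Rintegrable.
- exact: normal_Rintegrable.
Qed.

End normal_density_integral.

Lemma ae_eq_Rintegral d (T : measurableType d) (R : realType)
    (mu : {measure set T -> \bar R}) (f g : T -> R) :
  measurable_fun setT f -> measurable_fun setT g ->
  {ae mu, forall t, f t = g t} -> \int[mu]_t f t = \int[mu]_t g t.
Proof.
move=> mf mg fg; congr fine; apply: ae_eq_integral => //; try exact/measurable_EFinP.
by apply: filterS fg => t -> _.
Qed.

(** * Fubini's theorem for real-valued integrals *)

Section Rintegral_fubini.
Context d1 d2 (T1 : measurableType d1) (T2 : measurableType d2) (R : realType).
Variables (m1 : {sigma_finite_measure set T1 -> \bar R})
          (m2 : {sigma_finite_measure set T2 -> \bar R}).
Variable f : T1 * T2 -> R.
Hypothesis fi : Rintegrable (m1 \x m2)%E f.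

Lemma Rintegral_section1_ae :
  ae_eq m1 setT (fun x => \int[m2]_y (f (x, y))%:E)%E
    (fun x => (\int[m2]_y f (x, y))%:E).
Proof.
apply: filterS (ae_integrable1 fi) => x xi _.
by rewrite /Rintegral fineK//; exact: integrable_fin_num xi.
Qed.

Lemma Rintegral_section2_ae :
  ae_eq m2 setT (fun y => \int[m1]_x (f (x, y))%:E)%E
    (fun y => (\int[m1]_x f (x, y))%:E).
Proof.
apply: filterS (ae_integrable2 fi) => y yi _.
by rewrite /Rintegral fineK//; exact: integrable_fin_num yi.
Qed.

Lemma measurable_Rintegral_section1 :
  measurable_fun setT (fun x => \int[m2]_y f (x, y)).
Proof. by apply: measurableT_comp => //; exact: measurable_fubini_F fi. Qed.

Lemma measurable_Rintegral_section2 :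
  measurable_fun setT (fun y => \int[m1]_x f (x, y)).
Proof. by apply: measurableT_comp => //; exact: measurable_fubini_G fi. Qed.

(** As [fine] sends an infinite section integral to 0, the real-valued section integral is bounded
    in absolute value by the extended one at every point, exceptional or not. *)
Lemma Rintegrable_section1 : Rintegrable m1 (fun x => \int[m2]_y f (x, y)).
Proof.
apply: le_integrable (integrable_fubini_F fi) => //.
  exact/measurable_EFinP/measurable_Rintegral_section1.
by move=> x _ /=; rewrite /Rintegral /fubini_F; case: integral => //=; rewrite normr0 leey.
Qed.

Lemma Rintegrable_section2 : Rintegrable m2 (fun y => \int[m1]_x f (x, y)).
Proof.
have mf := measurable_int _ fi; apply/integrableP; split.
  exact/measurable_EFinP/measurable_Rintegral_section2.
apply: le_lt_trans ((integrable21ltyP m1 m2 mf).1 fi); apply: ge0_le_integral => //.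
- by apply: measurableT_comp => //; exact/measurable_EFinP/measurable_Rintegral_section2.
- exact: (measurable_fun_fubini_tonelli_G (m1 := m1) (abse \o (EFin \o f))
    (measurableT_comp (@abse_measurable _ setT) mf) (fun _ => abse_ge0 _)).
move=> y _; apply: (@le_trans _ _ `|\int[m1]_x (f (x, y))%:E|%E).
  by rewrite /= /Rintegral; case: integral => //=; rewrite normr0 leey.
apply: le_abse_integral => //.
exact: (measurable_fun_pair1 (f := EFin \o f)).
Qed.

Lemma Rintegral_fubini1 :
  \int[(m1 \x m2)%E]_z f z = \int[m1]_x \int[m2]_y f (x, y).
Proof.
rewrite /Rintegral -(integral12_prod_meas1 fi); congr fine.
apply: ae_eq_integral => //.
- exact: measurable_fubini_F fi.
- exact/measurable_EFinP/measurable_Rintegral_section1.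
- exact: Rintegral_section1_ae.
Qed.

Lemma Rintegral_fubini2 :
  \int[(m1 \x m2)%E]_z f z = \int[m2]_y \int[m1]_x f (x, y).
Proof.
rewrite /Rintegral -(integral21_prod_meas1 fi); congr fine.
apply: ae_eq_integral => //.
- exact: measurable_fubini_G fi.
- exact/measurable_EFinP/measurable_Rintegral_section2.
- exact: Rintegral_section2_ae.
Qed.

End Rintegral_fubini.

(* [normal_prob] and [uniform_prob] live on [measurableTypeR R], whose display is an
   opaque constant different from that of the measurable structure inferred for [R];
   these are copies on the latter. *)
Section real_probabilities.
Variable R : realType.

Definition unif01 : set R -> \bar R := uniform_prob (@ltr01 R).

Let unif01_0 : unif01 set0 = 0%E.
Proof. exact: (measure0 (uniform_prob (@ltr01 R))). Qed.

Let unif01_ge0 A : (0 <= unif01 A)%E.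
Proof. exact: (measure_ge0 (uniform_prob (@ltr01 R))). Qed.

Let unif01_sigma_additive : semi_sigma_additive unif01.
Proof. exact: (@measure_semi_sigma_additive _ _ _ (uniform_prob (@ltr01 R))). Qed.

HB.instance Definition _ := isMeasure.Build _ _ _
  unif01 unif01_0 unif01_ge0 unif01_sigma_additive.

Let unif01_setT : unif01 setT = 1%E.
Proof. exact: (@probability_setT _ _ _ (uniform_prob (@ltr01 R))). Qed.

HB.instance Definition _ := Measure_isProbability.Build _ _ R unif01 unif01_setT.

Definition gauss1 : set R -> \bar R := normal_prob 0 1.

Let gauss1_0 : gauss1 set0 = 0%E.
Proof. exact: (measure0 (normal_prob 0 1)). Qed.

Let gauss1_ge0 A : (0 <= gauss1 A)%E.
Proof. exact: (measure_ge0 (normal_prob 0 1)). Qed.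

Let gauss1_sigma_additive : semi_sigma_additive gauss1.
Proof. exact: (@measure_semi_sigma_additive _ _ _ (normal_prob 0 1)). Qed.

HB.instance Definition _ := isMeasure.Build _ _ _
  gauss1 gauss1_0 gauss1_ge0 gauss1_sigma_additive.

Let gauss1_setT : gauss1 setT = 1%E.
Proof. exact: (@probability_setT _ _ _ (normal_prob 0 1)). Qed.

HB.instance Definition _ := Measure_isProbability.Build _ _ R gauss1 gauss1_setT.

End real_probabilities.
Arguments unif01 {R}.
Arguments gauss1 {R}.

Section unit_interval.
Variable R : realType.

Local Notation unif01 := (@unif01 R).

Lemma ge0_integral_unif01 (f : R -> \bar R) : measurable_fun setT f ->
  (forall x, 0 <= f x)%E ->
  (\int[unif01]_x f x = \int[lebesgue_measure]_(x in `[0%R, 1%R]) f x)%E.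
Proof.
move=> mf f0; have := @integral_uniform R 0 1 ltr01 f mf f0.
rewrite subr0 invr1 mul1e => <-.
have -> : unif01 = pushforward (uniform_prob (@ltr01 R)) (idfun : measurableTypeR R -> R).
  by [].
by rewrite ge0_integral_pushforward// => _ Y mY; rewrite setTI; exact: mY.
Qed.

Lemma ge0_integral_gauss1 (f : R -> \bar R) : measurable_fun setT f ->
  (forall x, 0 <= f x)%E ->
  (\int[gauss1]_x f x = \int[normal_prob 0%R 1%R]_x f x)%E.
Proof.
move=> mf f0.
have -> : gauss1 = pushforward (normal_prob 0 1) (idfun : measurableTypeR R -> R).
  by [].
by rewrite ge0_integral_pushforward// => _ Y mY; rewrite setTI; exact: mY.
Qed.

Lemma Rintegral_unif01 (f : R -> R) : measurable_fun setT f ->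
  \int[unif01]_x f x = \int[lebesgue_measure]_(x in `[0, 1]) f x.
Proof.
move=> mf; rewrite /Rintegral; congr fine; rewrite integralE [RHS]integralE.
have mF : measurable_fun setT (EFin \o f) by exact/measurable_EFinP.
by rewrite !ge0_integral_unif01//; [exact: measurable_funeneg|exact: measurable_funepos].
Qed.

(* Almost surely the identity under [unif01]; it spares side conditions [0 <= s <= 1]. *)
Definition clip (s : R) : R := Num.max 0 (Num.min s 1).

Lemma clip_bounds s : 0 <= clip s <= 1.
Proof. by rewrite /clip le_max lexx/= ge_max ler01/= ge_min lexx orbT. Qed.

Lemma clip_id s : 0 <= s <= 1 -> clip s = s.
Proof. by move=> /andP[s0 s1]; rewrite /clip (min_idPl s1) (max_idPr s0). Qed.

Lemma measurable_clip : measurable_fun setT clip.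
Proof. by apply: measurable_maxr => //; exact: measurable_minr. Qed.

Context d (T : measurableType d) (P : probability T R).

(* Integrate the identity [F 1 x - F 0 x = \int_0^1 f s x ds] against [h dP]. *)
Lemma Rintegral_FTC_exchange (h X : T -> R) (F f : R -> R -> R) (C : R) :
  Rintegrable P h -> Rintegrable P (fun t => h t * X t) ->
  measurable_fun setT X ->
  measurable_fun [set: R * R] (fun z => f z.1 z.2) ->
  (forall s x, 0 <= s <= 1 -> `|f s x| <= C * (1 + `|x|)) ->
  (forall x s : R, is_derive s 1 (F ^~ x) (f s x)) ->
  (forall x, continuous (f ^~ x)) ->
  \int[P]_t (h t * (F 1 (X t) - F 0 (X t))) =
  \int[unif01]_s \int[P]_t (h t * f (clip s) (X t)).
Proof.
move=> hi hXi mX mf fC dF cf.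
have mh := Rintegrable_measurable hi.
have mK : measurable_fun [set: R * T] (fun z => h z.2 * f (clip z.1) (X z.2)).
  apply: measurable_funM; first exact: (measurableT_comp mh measurable_snd).
  apply: (@measurableT_comp _ _ _ _ _ _ (fun z : R * R => f z.1 z.2) _
    (fun z : R * T => (clip z.1, X z.2))) => //.
  apply/measurable_fun_pairP; split; first exact: (measurableT_comp measurable_clip measurable_fst).
  exact: (measurableT_comp mX measurable_snd).
have mKt t : measurable_fun [set: R] (fun s => h t * f (clip s) (X t)).
  apply: measurable_funM => //.
  exact: (measurableT_comp (measurable_fun_pair1 (f := fun z : R * R => f z.1 z.2) _ mf)
    measurable_clip).
(* Here [s] is integrated first: the linear bound on [f] makes that inner integral at most
   [C (|h| + |h X|)], which is integrable by hypothesis. *)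
have Ki : Rintegrable (unif01 \x P)%E (fun z => h z.2 * f (clip z.1) (X z.2)).
  apply/integrable21ltyP; first exact/measurable_EFinP.
  have bi : Rintegrable P (fun t => C * (`|h t| + `|h t * X t|)).
    by apply/RintegrableZl/RintegrableD; exact: integrable_norm.
  have /integrableP[mb] := bi; apply: le_lt_trans.
  apply: ge0_le_integral => //.
  - by move=> t _; exact: integral_ge0.
  - apply: (measurable_fun_fubini_tonelli_G (m1 := unif01)
      (fun z : R * T => (`|h z.2 * f (clip z.1) (X z.2)|)%:E)) => //.
    by apply/measurable_EFinP; exact: measurableT_comp.
  - exact: measurableT_comp.
  move=> t _; rewrite ge0_integral_unif01//; last first.
    by apply: measurableT_comp => //; apply/measurable_EFinP; exact: mKt.
  have mabs : measurable_fun [set: R] (fun s => (`|h t * f (clip s) (X t)|)%:E).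
    by apply/measurable_EFinP; apply: measurableT_comp => //; exact: mKt.
  apply: (@le_trans _ _ (\int[lebesgue_measure]_(s in `[0%R, 1%R])
      (C * (`|h t| + `|h t * X t|))%:E)%E).
    apply: ge0_le_integral => //=.
    - apply: measurable_funTS; exact: mabs.
    - move=> s _; rewrite lee_fin !normrM -[X in X + _]mulr1 -mulrDr.
      by rewrite mulrCA ler_wpM2l// fC// clip_bounds.
  rewrite integral_cst//= lebesgue_measure_itv/= lte_fin ltr01 sube0 mule1.
  by rewrite lee_fin ler_norm.
rewrite -(Rintegral_fubini1 Ki) (Rintegral_fubini2 Ki).
apply: eq_Rintegral => t _ /=.
rewrite Rintegral_unif01//.
transitivity (\int[lebesgue_measure]_(s in `[0, 1]) (h t * f s (X t))); last first.
  by apply: eq_Rintegral => s; rewrite inE/= in_itv/= => s01; rewrite clip_id.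
transitivity (h t * F 1 (X t) - h t * F 0 (X t)); first by rewrite mulrBr.
apply/esym; apply: (@Rintegral_FTC2 _ _ (fun s => h t * F s (X t))) => //.
- by move=> s; apply: cvgM; [exact: cvg_cst|exact: cf].
Qed.

End unit_interval.

Section gauss1_theory.
Variable R : realType.

Lemma gauss1_Rintegrable_normal (f : R -> R) : Rintegrable gauss1 f ->
  Rintegrable (normal_prob (0 : R) 1) f.
Proof.
move=> /integrableP[mf fi]; apply/integrableP; split => //.
by rewrite -ge0_integral_gauss1//; exact: measurableT_comp.
Qed.

Lemma Rintegral_gauss1 (f : R -> R) : measurable_fun setT f ->
  \int[gauss1]_x f x = \int[normal_prob (0 : R) 1]_x f x.
Proof.
move=> mf; rewrite /Rintegral; congr fine; rewrite integralE [RHS]integralE.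
have mF : measurable_fun setT (EFin \o f) by exact/measurable_EFinP.
by rewrite !ge0_integral_gauss1//; [exact: measurable_funeneg|exact: measurable_funepos].
Qed.

Lemma gauss1_integration_by_parts (f f' : R -> R) :
  (forall x : R, is_derive x 1 f (f' x)) -> continuous f' ->
  Rintegrable gauss1 f -> Rintegrable gauss1 f' ->
  Rintegrable gauss1 (fun x => x * f x) ->
  \int[gauss1]_x f' x = \int[gauss1]_x (x * f x).
Proof.
move=> df cf' fi f'i xfi; rewrite !Rintegral_gauss1; first last.
- exact: Rintegrable_measurable f'i.
- exact: Rintegrable_measurable xfi.
by apply: normal_integration_by_parts => //; exact: gauss1_Rintegrable_normal.
Qed.

Lemma gauss1_sqr_integrable : Rintegrable gauss1 (fun x : R => x ^+ 2).
Proof.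
apply/integrableP; split; first by apply/measurable_EFinP; exact: measurable_funX.
have mx2 : measurable_fun [set: R] (fun x : R => (`|x ^+ 2|)%:E).
  by apply/measurable_EFinP; apply: measurableT_comp => //; exact: measurable_funX.
rewrite ge0_integral_gauss1// ge0_integral_normal//.
(* From [1 + x^2 / 4 <= exp (x^2 / 4)] follows [x^2 exp (- x^2 / 2) <= 4 exp (- x^2 / 4)], a
   multiple of the normal density of variance 2. The constant [C] absorbs the two normalizations. *)
pose s : R := Num.sqrt 2; pose C : R := normal_peak 1 * 4 * (normal_peak s)^-1.
have s0 : s != 0 by rewrite gt_eqF// sqrtr_gt0.
have iC := @integrableZl _ _ _ lebesgue_measure setT measurableT C _
  (integrable_normal_pdf (0 : R) s).
have /integrableP[_] := iC; apply: le_lt_trans; apply: ge0_le_integral => //=.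
- by move=> x _; rewrite lee_fin mulr_ge0// normal_pdf_ge0.
- by apply: emeasurable_funM; [exact: mx2|apply/measurable_EFinP; exact: measurable_normal_pdf].
- have mp : measurable_fun [set: R] (fun x : R => (`|C * normal_pdf 0 s x|)%:E).
    apply/measurable_EFinP; apply: measurableT_comp => //; apply: measurable_funM => //.
    exact: measurable_normal_pdf.
  exact: mp.
move=> x _; rewrite lee_fin ger0_norm ?sqr_ge0//.
have C0 : 0 <= C by rewrite !mulr_ge0 ?invr_ge0 ?normal_peak_ge0.
rewrite ger0_norm ?(mulr_ge0 C0) ?normal_pdf_ge0//.
rewrite !normal_pdfE ?oner_neq0// /C /normal_fun !subr0 expr1n sqr_sqrtr//.
rewrite [leRHS](_ : _ = normal_peak 1 * (4 * expR (- x ^+ 2 / (2 *+ 2)))); last first.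
  by field; rewrite gt_eqF// normal_peak_gt0.
rewrite mulrCA ler_wpM2l ?normal_peak_ge0//.
rewrite (_ : - x ^+ 2 / 2 = - x ^+ 2 / (2 *+ 2) - x ^+ 2 / 4); last first.
  by field.
rewrite expRD mulrCA mulrC ler_wpM2r ?expR_ge0// expRN.
rewrite ler_pdivrMr ?expR_gt0//.
have := expR_ge1Dx (x ^+ 2 / 4); lra.
Qed.

End gauss1_theory.

(** * Normalized waves as functions of the dilation [s] *)

Section mode.
Variable R : realType.
Implicit Types A b s y : R.

(* [mode (|a|^2) b s (a . x)] is the wave [E_s x]. *)
Definition mode A b s y := expR (s ^+ 2 * A / 2) * cos (s * y + b).
Definition dmode A b s y :=
  expR (s ^+ 2 * A / 2) * (s * A * cos (s * y + b) - y * sin (s * y + b)).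

Lemma is_derive_mode A b y s : is_derive s 1 (mode A b ^~ y) (dmode A b s y).
Proof.
have D1 : is_derive s 1 (fun s : R => s ^+ 2 * A / 2) (s * A).
  by apply: is_derive_eq; rewrite /GRing.scale/=; field.
have D2 : is_derive s 1 (fun s : R => s * y + b) y.
  by apply: is_derive_eq; rewrite /GRing.scale/=; ring.
have D3 := @is_derive1_comp _ expR _ s _ _ (is_derive_expR _) D1.
have D4 := @is_derive1_comp _ cos _ s _ _ (is_derive_cos _) D2.
rewrite (_ : mode A b ^~ y = (expR \o (fun s : R => s ^+ 2 * A / 2)) *
   (cos \o (fun s : R => s * y + b)))//.
apply: is_derive_eq; rewrite /GRing.scale/= /dmode; ring.
Qed.

Lemma continuous_mode_aux A b y :
  continuous (fun s : R => expR (s ^+ 2 * A / 2)) /\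
  continuous (fun s : R => cos (s * y + b)) /\
  continuous (fun s : R => sin (s * y + b)).
Proof.
have c1 : continuous (fun s : R => s * y + b).
  by move=> s; apply: cvgD; [apply: cvgM; [exact: cvg_id|exact: cvg_cst]|exact: cvg_cst].
split; [|split] => s.
- apply: (@continuous_comp _ _ _ (fun s : R => s ^+ 2 * A / 2) expR); last exact: continuous_expR.
  apply: cvgM; last exact: cvg_cst.
  by apply: cvgM; [exact: exprn_continuous|exact: cvg_cst].
- by apply: (@continuous_comp _ _ _ (fun s : R => s * y + b) cos); [exact: c1|exact: continuous_cos].
- by apply: (@continuous_comp _ _ _ (fun s : R => s * y + b) sin); [exact: c1|exact: continuous_sin].
Qed.

Lemma continuous_mode A b y : continuous (mode A b ^~ y).
Proof.
have [c1 [c2 _]] := continuous_mode_aux A b y.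
by move=> s; apply: cvgM; [exact: c1|exact: c2].
Qed.

Lemma continuous_dmode A b y : continuous (dmode A b ^~ y).
Proof.
have [c1 [c2 c3]] := continuous_mode_aux A b y.
move=> s; apply: cvgM; first exact: c1.
apply: cvgB; apply: cvgM; [|exact: c2|exact: cvg_cst|exact: c3].
by apply: cvgM; [exact: cvg_id|exact: cvg_cst].
Qed.

Lemma mode_bounds A b s y : 0 <= A -> 0 <= s <= 1 ->
  `|mode A b s y| <= expR (A / 2) /\
  `|dmode A b s y| <= expR (A / 2) * (A + `|y|).
Proof.
move=> A0 /andP[s0 s1].
have sA : s ^+ 2 * A / 2 <= A / 2.
  by rewrite ler_wpM2r// ler_piMl// exprn_ile1.
have e1 : expR (s ^+ 2 * A / 2) <= expR (A / 2) by rewrite ler_expR.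
have c1 : `|cos (s * y + b)| <= 1 by rewrite ler_norml cos_geN1 cos_le1.
have c2 : `|sin (s * y + b)| <= 1 by rewrite ler_norml sin_geN1 sin_le1.
split.
  rewrite normrM ger0_norm ?expR_ge0// -[leRHS]mulr1.
  exact: ler_pM.
rewrite normrM ger0_norm ?expR_ge0//; apply: ler_pM => //.
apply: le_trans (ler_normB _ _) _; apply: lerD; rewrite normrM.
  rewrite -[leRHS]mulr1; apply: ler_pM => //.
  by rewrite ger0_norm ?mulr_ge0// ler_piMl.
by rewrite -[leRHS]mulr1; apply: ler_pM.
Qed.

Lemma measurable_mode A b :
  measurable_fun [set: R * R] (fun z => mode A b z.1 z.2).
Proof.
apply: measurable_funM.
  apply: measurableT_comp => //; apply: measurable_funM => //; apply: measurable_funM => //.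
  exact: measurable_funX.
apply: measurableT_comp; first by apply: continuous_measurable_fun; exact: continuous_cos.
by apply: measurable_funD => //; exact: measurable_funM.
Qed.

Lemma measurable_dmode A b :
  measurable_fun [set: R * R] (fun z => dmode A b z.1 z.2).
Proof.
have mz : measurable_fun [set: R * R] (fun z => z.1 * z.2 + b).
  by apply: measurable_funD => //; exact: measurable_funM.
apply: measurable_funM.
  apply: measurableT_comp => //; apply: measurable_funM => //; apply: measurable_funM => //.
  exact: measurable_funX.
apply: measurable_funB; apply: measurable_funM => //.
- exact: measurable_funM.
- by apply: measurableT_comp mz; apply: continuous_measurable_fun; exact: continuous_cos.
- by apply: measurableT_comp mz; apply: continuous_measurable_fun; exact: continuous_sin.
Qed.

End mode.

(** * Laws determined by their waves *)

Section transfer_real.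
Context d d' (T : measurableType d) (T' : measurableType d') (R : realType).
Variables (P : probability T R) (X : {mfun T >-> T'}).

Lemma Rintegral_distribution (f : T' -> R) : measurable_fun setT f ->
  \int[distribution P X]_y f y = \int[P]_x f (X x).
Proof.
move=> mf; rewrite /Rintegral; congr fine; rewrite integralE [RHS]integralE.
have mF : measurable_fun setT (EFin \o f) by exact/measurable_EFinP.
rewrite (ge0_integral_distribution X (measurable_funepos mF) (funepos_ge0 _)).
rewrite (ge0_integral_distribution X (measurable_funeneg mF) (funeneg_ge0 _)).
by congr (_ - _)%E; apply: eq_integral => x _; rewrite /= ?funeposE ?funenegE.
Qed.

End transfer_real.

Section equal_laws.
Context d d' (T : measurableType d) (T' : measurableType d') (R : realType) (n : nat).
Variables (P : probability T R) (P' : probability T' R).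
Variables (Z : T -> n.-tuple R) (Z' : T' -> n.-tuple R).
Hypotheses (mZ : measurable_fun setT Z) (mZ' : measurable_fun setT Z').
Hypothesis eq_wave : forall (a : 'I_n -> R) b,
  \int[P]_t cos (\sum_i a i * tnth (Z t) i + b) =
  \int[P']_t cos (\sum_i a i * tnth (Z' t) i + b).

Let mfZ := isMeasurableFun.Build _ _ _ _ _ mZ.
Let fZ : {mfun T >-> n.-tuple R} := HB.pack Z mfZ.
Let mfZ' := isMeasurableFun.Build _ _ _ _ _ mZ'.
Let fZ' : {mfun T' >-> n.-tuple R} := HB.pack Z' mfZ'.

Let eq_dist A : measurable A -> distribution P fZ A = distribution P' fZ' A.
Proof.
apply: eq_measure_tuple => a b.
have mo := @measurable_osc _ _ R n (fun i (t : n.-tuple R) => tnth t i)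
  (fun i => measurable_tnth i) a b.
by rewrite !Rintegral_distribution//; exact: eq_wave.
Qed.

Lemma ge0_integral_eq_law (f : n.-tuple R -> \bar R) : measurable_fun setT f ->
  (forall t, 0 <= f t)%E -> (\int[P]_t f (Z t) = \int[P']_t f (Z' t))%E.
Proof.
move=> mf f0.
have := @ge0_integral_distribution _ _ _ _ _ P fZ f mf f0 => /= <-.
have := @ge0_integral_distribution _ _ _ _ _ P' fZ' f mf f0 => /= <-.
by apply: eq_measure_integral => A mA _; exact: eq_dist.
Qed.

Lemma Rintegral_eq_law (f : n.-tuple R -> R) : measurable_fun setT f ->
  \int[P]_t f (Z t) = \int[P']_t f (Z' t).
Proof.
move=> mf; have /= <- := @Rintegral_distribution _ _ _ _ _ P fZ f mf.
have /= <- := @Rintegral_distribution _ _ _ _ _ P' fZ' f mf.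
by congr fine; apply: eq_measure_integral => A mA _; exact: eq_dist.
Qed.

Lemma Rintegrable_eq_law (f : n.-tuple R -> R) : measurable_fun setT f ->
  Rintegrable P (fun t => f (Z t)) -> Rintegrable P' (fun t => f (Z' t)).
Proof.
move=> mf /integrableP[_ h]; apply/integrableP; split.
  by apply/measurable_EFinP; exact: measurableT_comp.
have E := ge0_integral_eq_law (f := fun t => (`|f t|)%:E).
rewrite -E//; apply/measurable_EFinP; exact: measurableT_comp.
Qed.

End equal_laws.

(** * Construction of the Gaussian measure, and its characteristic function on the line *)

Section gauss_tuple.
Variable R : realType.

Section cons_pair.
Variable m : nat.
Definition cons_pair (z : R * m.-tuple R) : m.+1.-tuple R := [tuple of z.1 :: z.2].

Lemma measurable_cons_pair : measurable_fun setT cons_pair.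
Proof. exact: (measurable_cons measurable_fst measurable_snd). Qed.

HB.instance Definition _ := isMeasurableFun.Build _ _ _ _ cons_pair measurable_cons_pair.
End cons_pair.

(** Built one coordinate at a time, in step with the recursion of [gauss_int], so that the two can
    be compared by induction. *)
Fixpoint gam (m : nat) : probability (m.-tuple R) R :=
  match m with
  | 0 => dirac [tuple]
  | m'.+1 => distribution (gauss1 \x gam m')%E (@cons_pair m')
  end.

Lemma ge0_integral_gam_cons m (f : m.+1.-tuple R -> \bar R) :
  measurable_fun setT f -> (forall t, 0 <= f t)%E ->
  (\int[gam m.+1]_t f t = \int[gauss1]_x \int[gam m]_t f (cons_pair (x, t)))%E.
Proof.
move=> mf f0; rewrite /= ge0_integral_distribution//.
have mc : measurable_fun setT (f \o @cons_pair m).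
  exact: measurableT_comp mf (@measurable_cons_pair m).
exact: (fubini_tonelli1 _ mc (fun z => f0 _)).
Qed.

Lemma gauss1_id_integrable : Rintegrable gauss1 (fun x : R => x).
Proof.
apply: (@Rintegrable_le _ _ _ _ _ (fun x : R => 1 + x ^+ 2)) => //.
  apply: RintegrableD; last exact: gauss1_sqr_integrable.
  by apply: (@bounded_Rintegrable _ _ _ _ _ 1) => // t; rewrite normr1.
by move=> t; rewrite ler_norml; nra.
Qed.

Lemma measurable_cos_affine (a b : R) : measurable_fun setT (fun x : R => cos (a * x + b)).
Proof.
apply: measurableT_comp; first by apply: continuous_measurable_fun; exact: continuous_cos.
by apply: measurable_funD => //; exact: measurable_funM.
Qed.

Lemma measurable_sin_affine (a b : R) : measurable_fun setT (fun x : R => sin (a * x + b)).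
Proof.
apply: measurableT_comp; first by apply: continuous_measurable_fun; exact: continuous_sin.
by apply: measurable_funD => //; exact: measurable_funM.
Qed.

(** The mean of [E_s] does not depend on [s]: with [p = exp (s^2 a^2 / 2) a sin (s a x + b)], its
    [s]-derivative has the form [p' - x p], which Gaussian integration by parts sends to 0.
    Comparing [s = 1] with [s = 0], where the wave is the constant [cos b], yields the formula. *)
Lemma gauss1_wave (a b : R) :
  \int[gauss1]_x cos (a * x + b) = expR (- a ^+ 2 / 2) * cos b.
Proof.
have ci k c : Rintegrable gauss1 (fun x : R => cos (k * x + c)).
  apply: (@bounded_Rintegrable _ _ _ _ _ 1) => [|t]; first exact: measurable_cos_affine.
  by rewrite ler_norml cos_geN1 cos_le1.
have si k c : Rintegrable gauss1 (fun x : R => sin (k * x + c)).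
  apply: (@bounded_Rintegrable _ _ _ _ _ 1) => [|t]; first exact: measurable_sin_affine.
  by rewrite ler_norml sin_geN1 sin_le1.
have i1 : Rintegrable gauss1 (fun _ : R => 1 : R).
  by apply: (@bounded_Rintegrable _ _ _ _ _ 1) => // t; rewrite normr1.
have xsi k c : Rintegrable gauss1 (fun x : R => x * sin (k * x + c)).
  apply: (Rintegrable_bddM (M := 1) gauss1_id_integrable (measurable_sin_affine k c)).
  by move=> t; rewrite ler_norml sin_geN1 sin_le1.
have mci k c : measurable_fun [set: R] (fun x => cos (k * x + c)) by exact: measurable_cos_affine.
have inner s : \int[gauss1]_x (1 * dmode (a ^+ 2) b s (a * x)) = 0.
  pose e := expR (s ^+ 2 * a ^+ 2 / 2).
  pose p x := e * a * sin (s * a * x + b).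
  pose p' x := e * a * (s * a) * cos (s * a * x + b).
  have pi' : Rintegrable gauss1 p' by exact: RintegrableZl.
  have xpi : Rintegrable gauss1 (fun x => x * p x).
    rewrite (_ : (fun x => _) = (fun x => e * a * (x * sin (s * a * x + b)))).
      exact: RintegrableZl.
    by apply/funext => x; rewrite /p; ring.
  have ibp : \int[gauss1]_x p' x = \int[gauss1]_x (x * p x).
    apply: gauss1_integration_by_parts => //; last exact: RintegrableZl.
    - move=> x.
      have D2 : is_derive x 1 (fun x : R => s * a * x + b) (s * a).
        by apply: is_derive_eq; rewrite /GRing.scale/=; ring.
      have D4 := @is_derive1_comp _ sin _ x _ _ (is_derive_sin _) D2.
      rewrite (_ : p = (e * a) \*: (sin \o (fun x : R => s * a * x + b)))//.
      by apply: is_derive_eq; rewrite /GRing.scale/= /p'; ring.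
    - move=> x; apply: cvgM; first exact: cvg_cst.
      apply: (@continuous_comp _ _ _ (fun x : R => s * a * x + b) cos); last exact: continuous_cos.
      by apply: cvgD; [apply: cvgM; [exact: cvg_cst|exact: cvg_id]|exact: cvg_cst].
  transitivity (\int[gauss1]_x (p' x - x * p x)).
    apply: eq_Rintegral => x _; rewrite /dmode /p /p' /e [s * (a * x)]mulrA; ring.
  by rewrite RintegralB// ibp subrr.
have ex : \int[gauss1]_x (1 * (mode (a ^+ 2) b 1 (a * x) - mode (a ^+ 2) b 0 (a * x))) =
    \int[unif01]_s \int[gauss1]_x (1 * dmode (a ^+ 2) b (clip s) (a * x)).
  apply: (@Rintegral_FTC_exchange _ _ _ _ _ _ _ _ (expR (a ^+ 2 / 2) * (a ^+ 2 + 1))) => //.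
  - rewrite (_ : (fun x => _) = (fun x => a * x)); last by apply/funext => x; rewrite mul1r.
    by apply: RintegrableZl; exact: gauss1_id_integrable.
  - exact: measurable_dmode.
  - move=> s x s01; apply: le_trans (mode_bounds b x (sqr_ge0 a) s01).2 _.
    rewrite -mulrA ler_wpM2l ?expR_ge0//.
    by have := sqr_ge0 a; have := normr_ge0 x; nra.
  - by move=> x s; exact: is_derive_mode.
  - by move=> x; exact: continuous_dmode.
move: ex; under [RHS]eq_Rintegral do rewrite inner.
rewrite Rintegral_prob_cst => ex.
have : \int[gauss1]_x (expR (a ^+ 2 / 2) * cos (a * x + b) - cos b) = 0.
  rewrite -[RHS]ex; apply: eq_Rintegral => x _.
  by rewrite /mode expr1n expr0n/= !mul0r expR0 !mul1r add0r.
rewrite RintegralB//; [|exact: RintegrableZl|]; last first.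
  by apply: (@bounded_Rintegrable _ _ _ _ _ 1) => // t; rewrite ler_norml cos_geN1 cos_le1.
rewrite RintegralZl// Rintegral_prob_cst => /eqP.
rewrite subr_eq0 => /eqP <-; rewrite mulNr expRN mulrA mulVf ?mul1r//.
by rewrite gt_eqF// expR_gt0.
Qed.

End gauss_tuple.

(** * The Gaussian measure on tuples *)

Section gauss_tuple_laws.
Variable R : realType.
Local Notation gam := (@gam R).

Lemma cos_bounded_integrable d (T : measurableType d) (P : probability T R) (f : T -> R) :
  measurable_fun setT f -> Rintegrable P (fun t => cos (f t)).
Proof.
move=> mf; apply: (@bounded_Rintegrable _ _ _ _ _ 1) => [|t].
  by apply: measurableT_comp mf; apply: continuous_measurable_fun; exact: continuous_cos.
by rewrite ler_norml cos_geN1 cos_le1.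
Qed.

Lemma measurable_affine_tuple m (a : 'I_m -> R) b :
  measurable_fun [set: m.-tuple R] (fun t => \sum_i a i * tnth t i + b).
Proof.
apply: measurable_funD => //; apply: measurable_sum => i.
by apply: measurable_funM => //; exact: measurable_tnth.
Qed.

(** Carrying an arbitrary phase [b] makes the induction close: the split-off term [a ord0 * x] joins
    the phase while the other coordinates are integrated. *)
Lemma gam_wave m (a : 'I_m -> R) b :
  \int[gam m]_t cos (\sum_i a i * tnth t i + b) =
  expR (- (\sum_i a i ^+ 2) / 2) * cos b.
Proof.
elim: m a b => [|m IH] a b.
  rewrite big_ord0 oppr0 mul0r expR0 mul1r.
  under eq_Rintegral do rewrite big_ord0 add0r.
  by rewrite Rintegral_prob_cst.
have mo := @measurable_osc _ _ R m.+1 (fun i (t : m.+1.-tuple R) => tnth t i)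
  (fun i => measurable_tnth i) a b.
rewrite /= Rintegral_distribution//.
have mc : measurable_fun setT (fun z => \sum_i a i * tnth (@cons_pair R m z) i + b).
  exact: (measurableT_comp (measurable_affine_tuple a b) (@measurable_cons_pair R m)).
have ci := cos_bounded_integrable (gauss1 \x gam m)%E mc.
rewrite (Rintegral_fubini1 ci).
have E x (t : m.-tuple R) : \sum_i a i * tnth (cons_pair (x, t)) i + b =
    \sum_i a (lift ord0 i) * tnth t i + (a ord0 * x + b).
  rewrite big_ord_recl /cons_pair/= tnth0 -addrA addrCA.
  by congr (_ + _); apply: eq_bigr => i _; rewrite tnthS.
under eq_Rintegral.
  move=> x _; under eq_Rintegral do rewrite E.
  rewrite IH; over.
rewrite RintegralZl//; last first.
  by apply: cos_bounded_integrable; apply: measurable_funD => //; exact: measurable_funM.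
by rewrite gauss1_wave mulrA -expRD big_ord_recl/= -mulrDl -opprD addrC.
Qed.

(* A law is Gaussian as soon as its linear images have Gaussian characteristic functions. *)
Section gaussian_law.
Context d (T : measurableType d) (P : probability T R) (m : nat) (Z : T -> m.-tuple R).
Hypothesis mZ : measurable_fun setT Z.
Hypothesis wave : forall a b, \int[P]_t cos (\sum_i a i * tnth (Z t) i + b) =
  expR (- (\sum_i a i ^+ 2) / 2) * cos b.

Let eq_wave a b : \int[P]_t cos (\sum_i a i * tnth (Z t) i + b) =
  \int[gam m]_t cos (\sum_i a i * tnth t i + b).
Proof. by rewrite wave gam_wave. Qed.

Lemma ge0_integral_gaussian_law (f : m.-tuple R -> \bar R) : measurable_fun setT f ->
  (forall t, 0 <= f t)%E -> (\int[P]_t f (Z t) = \int[gam m]_t f t)%E.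
Proof. exact: (ge0_integral_eq_law mZ (@measurable_id _ _ setT) eq_wave). Qed.

Lemma Rintegral_gaussian_law (f : m.-tuple R -> R) : measurable_fun setT f ->
  \int[P]_t f (Z t) = \int[gam m]_t f t.
Proof. exact: (Rintegral_eq_law mZ (@measurable_id _ _ setT) eq_wave). Qed.

Lemma Rintegrable_gaussian_law (f : m.-tuple R -> R) : measurable_fun setT f ->
  Rintegrable (gam m) f <-> Rintegrable P (fun t => f (Z t)).
Proof.
move=> mf; split.
  apply: (Rintegrable_eq_law (@measurable_id _ _ setT) mZ _ mf) => a b.
  exact/esym/eq_wave.
exact: (Rintegrable_eq_law mZ (@measurable_id _ _ setT) eq_wave mf).
Qed.

End gaussian_law.

Section insertion.
Variables (m : nat) (i : 'I_m.+1).

(** The construction of [gam] splits off only the first coordinate; with this map any coordinate [i]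
    can be singled out, since the characteristic function shows that the Gaussian law is
    preserved. *)
Definition insert (z : R * m.-tuple R) : m.+1.-tuple R :=
  [tuple if unlift i j is Some k then tnth z.2 k else z.1 | j < m.+1].

Lemma tnth_insert_eq z : tnth (insert z) i = z.1.
Proof. by rewrite tnth_mktuple unlift_none. Qed.

Lemma tnth_insert_lift z k : tnth (insert z) (lift i k) = tnth z.2 k.
Proof. by rewrite tnth_mktuple liftK. Qed.

Lemma measurable_insert : measurable_fun setT insert.
Proof.
apply/measurable_fun_tnthP => j.
case: (unliftP i j) => [k|] ->.
  rewrite (_ : _ \o _ = (fun z : R * m.-tuple R => tnth z.2 k)).
    exact: (measurableT_comp (measurable_tnth k) measurable_snd).
  by apply/funext => z /=; rewrite tnth_insert_lift.
rewrite (_ : _ \o _ = fst); first exact: measurable_fst.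
by apply/funext => z /=; rewrite tnth_insert_eq.
Qed.

Lemma sum_insert (F : 'I_m.+1 -> R -> R) z :
  \sum_j F j (tnth (insert z) j) = F i z.1 + \sum_k F (lift i k) (tnth z.2 k).
Proof.
rewrite (bigD1_ord i)//= tnth_insert_eq; congr (_ + _).
by apply: eq_bigr => k _; rewrite tnth_insert_lift.
Qed.

Lemma insert_wave a b :
  \int[(gauss1 \x gam m)%E]_z cos (\sum_j a j * tnth (insert z) j + b) =
  expR (- (\sum_j a j ^+ 2) / 2) * cos b.
Proof.
have mc : measurable_fun setT (fun z => \sum_j a j * tnth (insert z) j + b).
  exact: (measurableT_comp (measurable_affine_tuple a b) measurable_insert).
have ci := cos_bounded_integrable (gauss1 \x gam m)%E mc.
rewrite (Rintegral_fubini1 ci).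
have E x (t : m.-tuple R) : \sum_j a j * tnth (insert (x, t)) j + b =
    \sum_k a (lift i k) * tnth t k + (a i * x + b).
  by rewrite (sum_insert (fun j y => a j * y))/= -addrA addrCA.
under eq_Rintegral.
  move=> x _; under eq_Rintegral do rewrite E.
  rewrite gam_wave; over.
rewrite RintegralZl//; last first.
  by apply: cos_bounded_integrable; apply: measurable_funD => //; exact: measurable_funM.
by rewrite gauss1_wave mulrA -expRD (bigD1_ord i)//= -mulrDl -opprD addrC.
Qed.

End insertion.

Section rotation.
Variables (m : nat) (s c : R).

Definition lincomb (x y : m.-tuple R) : m.-tuple R :=
  [tuple s * tnth x i + c * tnth y i | i < m].

Lemma measurable_lincomb : measurable_fun [set: m.-tuple R * m.-tuple R]
  (fun z => lincomb z.1 z.2).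
Proof.
apply/measurable_fun_tnthP => i.
rewrite (_ : _ \o _ = (fun z : m.-tuple R * m.-tuple R => s * tnth z.1 i + c * tnth z.2 i)).
  apply: measurable_funD; apply: measurable_funM => //.
    exact: (measurableT_comp (measurable_tnth i) measurable_fst).
  exact: (measurableT_comp (measurable_tnth i) measurable_snd).
by apply/funext => z /=; rewrite tnth_mktuple.
Qed.

(** Equality of laws is established for tuples, so a pair of vectors is encoded as one vector of
    double length. *)
Definition pair_tuple (z : m.-tuple R * m.-tuple R) : (m + m).-tuple R :=
  [tuple match fintype.split i with inl j => tnth z.1 j | inr j => tnth z.2 j end | i < m + m].

Definition tuple_pair (t : (m + m).-tuple R) : m.-tuple R * m.-tuple R :=
  ([tuple tnth t (lshift m i) | i < m], [tuple tnth t (rshift m i) | i < m]).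

Lemma pair_tupleK : cancel pair_tuple tuple_pair.
Proof.
move=> [x y]; rewrite /tuple_pair; congr pair; apply: eq_from_tnth => i.
  by rewrite !tnth_mktuple (unsplitK (inl i)).
by rewrite !tnth_mktuple (unsplitK (inr i)).
Qed.

Lemma measurable_pair_tuple : measurable_fun setT pair_tuple.
Proof.
apply/measurable_fun_tnthP => i.
rewrite (_ : _ \o _ = (fun z => match fintype.split i with inl j => tnth z.1 j | inr j => tnth z.2 j end)).
  case: fintype.split => j.
    exact: (measurableT_comp (measurable_tnth j) measurable_fst).
  exact: (measurableT_comp (measurable_tnth j) measurable_snd).
by apply/funext => z /=; rewrite tnth_mktuple.
Qed.

Lemma measurable_tuple_pair : measurable_fun setT tuple_pair.
Proof.
apply/measurable_fun_pairP; split; apply/measurable_fun_tnthP => i.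
  rewrite (_ : _ \o _ = (fun t : (m + m).-tuple R => tnth t (lshift m i))).
    exact: measurable_tnth.
  by apply/funext => z /=; rewrite tnth_mktuple.
rewrite (_ : _ \o _ = (fun t : (m + m).-tuple R => tnth t (rshift m i))).
  exact: measurable_tnth.
by apply/funext => z /=; rewrite tnth_mktuple.
Qed.

Lemma pair_wave (a a' : 'I_m -> R) b :
  \int[(gam m \x gam m)%E]_z
    cos (\sum_i a i * tnth z.1 i + \sum_i a' i * tnth z.2 i + b) =
  expR (- (\sum_i (a i ^+ 2 + a' i ^+ 2)) / 2) * cos b.
Proof.
have mc : measurable_fun [set: m.-tuple R * m.-tuple R]
    (fun z => \sum_i a i * tnth z.1 i + \sum_i a' i * tnth z.2 i + b).
  apply: measurable_funD => //; apply: measurable_funD; apply: measurable_sum => i;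
    apply: measurable_funM => //.
    exact: (measurableT_comp (measurable_tnth i) measurable_fst).
  exact: (measurableT_comp (measurable_tnth i) measurable_snd).
have ci := cos_bounded_integrable (gam m \x gam m)%E mc.
rewrite (Rintegral_fubini1 ci).
transitivity (\int[gam m]_x (expR (- (\sum_i a' i ^+ 2) / 2) *
    cos (\sum_i a i * tnth x i + b))).
  apply: eq_Rintegral => x _; rewrite -gam_wave.
  by apply: eq_Rintegral => y _ /=; congr cos; ring.
rewrite RintegralZl//; last by apply: cos_bounded_integrable; exact: measurable_affine_tuple.
by rewrite gam_wave mulrA -expRD big_split/= -mulrDl -opprD addrC.
Qed.

Hypothesis sc1 : s ^+ 2 + c ^+ 2 = 1.

Lemma lincomb_wave a b :
  \int[(gam m \x gam m)%E]_z cos (\sum_i a i * tnth (lincomb z.1 z.2) i + b) =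
  expR (- (\sum_i a i ^+ 2) / 2) * cos b.
Proof.
transitivity (\int[(gam m \x gam m)%E]_z
    cos (\sum_i (a i * s) * tnth z.1 i + \sum_i (a i * c) * tnth z.2 i + b)).
  apply: eq_Rintegral => z _; congr cos; rewrite -big_split/=; congr (_ + _).
  by apply: eq_bigr => i _; rewrite tnth_mktuple; ring.
rewrite pair_wave; congr (expR (- _ / 2) * _); apply: eq_bigr => i _.
by rewrite !exprMn -mulrDr sc1 mulr1.
Qed.

Let Z1 (z : m.-tuple R * m.-tuple R) := pair_tuple (z.1, lincomb z.1 z.2).
Let Z2 (z : m.-tuple R * m.-tuple R) := pair_tuple (lincomb z.1 z.2, z.1).

Let mZ1 : measurable_fun setT Z1.
Proof.
apply: (measurableT_comp measurable_pair_tuple).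
by apply/measurable_fun_pairP; split; [exact: measurable_fst|exact: measurable_lincomb].
Qed.

Let mZ2 : measurable_fun setT Z2.
Proof.
apply: (measurableT_comp measurable_pair_tuple).
by apply/measurable_fun_pairP; split; [exact: measurable_lincomb|exact: measurable_fst].
Qed.

(** With [l] and [r] the two halves of [a], both exponents come from the quadratic form
    [|l|^2 + |r|^2 + 2 s l . r] once [c^2 = 1 - s^2], and this form is symmetric in [l] and [r]. *)
Let exchangeable_wave a b :
  \int[(gam m \x gam m)%E]_z cos (\sum_i a i * tnth (Z1 z) i + b) =
  \int[(gam m \x gam m)%E]_z cos (\sum_i a i * tnth (Z2 z) i + b).
Proof.
pose l (i : 'I_m) := a (lshift m i); pose r (i : 'I_m) := a (rshift m i).
transitivity (\int[(gam m \x gam m)%E]_z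
    cos (\sum_i (l i + s * r i) * tnth z.1 i + \sum_i (c * r i) * tnth z.2 i + b)).
  apply: eq_Rintegral => z _; congr (cos (_ + _)).
  rewrite big_split_ord/= -!big_split/=; apply: eq_bigr => i _.
  rewrite /Z1 !tnth_mktuple (unsplitK (inl i)) (unsplitK (inr i))/= tnth_mktuple /l /r; ring.
transitivity (\int[(gam m \x gam m)%E]_z
    cos (\sum_i (s * l i + r i) * tnth z.1 i + \sum_i (c * l i) * tnth z.2 i + b)); last first.
  apply: eq_Rintegral => z _; congr (cos (_ + _)).
  rewrite big_split_ord/= -!big_split/=; apply: eq_bigr => i _.
  rewrite /Z2 !tnth_mktuple (unsplitK (inl i)) (unsplitK (inr i))/= tnth_mktuple /l /r; ring.
rewrite !pair_wave; congr (expR (- _ / 2) * _); apply: eq_bigr => i _.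
rewrite !exprMn (_ : c ^+ 2 = 1 - s ^+ 2); last by rewrite -sc1; ring.
ring.
Qed.

(* [(x, s x + c y)] and [(s x + c y, x)] have the same law. *)
Lemma Rintegral_exchangeable (f : m.-tuple R * m.-tuple R -> R) :
  measurable_fun setT f ->
  \int[(gam m \x gam m)%E]_z f (z.1, lincomb z.1 z.2) =
  \int[(gam m \x gam m)%E]_z f (lincomb z.1 z.2, z.1).
Proof.
move=> mf.
have := @Rintegral_eq_law _ _ _ _ _ _ _ _ _ _ mZ1 mZ2 exchangeable_wave
  (f \o tuple_pair) (measurableT_comp mf measurable_tuple_pair).
by rewrite /Z1 /Z2 /=; under eq_Rintegral do rewrite pair_tupleK;
  under [X in _ = X -> _]eq_Rintegral do rewrite pair_tupleK.
Qed.

End rotation.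

End gauss_tuple_laws.

(** * Gaussian integration by parts *)

Section gauss_int_gam.
Variable R : realType.
Local Notation gam := (@gam R).

Definition rv m (t : m.-tuple R) : 'rV[R]_m := \row_i tnth t i.

Lemma rv_cons m x (t : m.-tuple R) :
  rv (cons_pair (x, t)) = row_mx (const_mx x : 'rV_1) (rv t).
Proof.
apply/rowP => i; rewrite [LHS]mxE; case: (@split_ordP 1 m i) => j ->.
  rewrite (row_mxEl (const_mx x : 'rV_1)) mxE (ord1 j).
  by rewrite (_ : lshift m 0 = ord0) ?tnth0//; exact/val_inj.
rewrite (row_mxEr (const_mx x : 'rV_1)) mxE.
by rewrite (_ : rshift 1 j = lift ord0 j) ?tnthS//; exact/val_inj.
Qed.

(** This turns the iterated integrals behind the energy and the distances into integrals for one
    probability on tuples, to which Fubini and Fourier injectivity apply. *)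
Lemma gauss_int_gam m (f : 'rV[R]_m -> \bar R) :
  measurable_fun [set: m.-tuple R] (fun t => f (rv t)) -> (forall x, 0 <= f x)%E ->
  gauss_int f = (\int[gam m]_t f (rv t))%E.
Proof.
elim: m f => [|m IH] f mf f0.
  rewrite /= integral_dirac// diracT mul1e; congr f.
  by apply/rowP => -[].
rewrite ge0_integral_gam_cons// ge0_integral_gauss1; last 2 first.
- apply: (measurable_fun_fubini_tonelli_F (m2 := gam m)
    (fun z : R * m.-tuple R => f (rv (cons_pair z)))) => //.
  exact: (measurableT_comp mf (@measurable_cons_pair R m)).
- by move=> x; exact: integral_ge0.
apply: eq_integral => x _.
transitivity (\int[gam m]_t f (row_mx (const_mx x : 'rV_1) (rv t)))%E; last first.
  by apply: eq_integral => t _; rewrite rv_cons.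
apply: IH => //.
rewrite (_ : (fun t => _) = (fun t => f (rv (cons_pair (x, t))))).
  exact: (measurable_fun_pair2 (f := fun z => f (rv (cons_pair z))) x
    (measurableT_comp mf (@measurable_cons_pair R m))).
by apply/funext => t; rewrite rv_cons.
Qed.

Lemma rv_insert m (i : 'I_m.+1) x (t : m.-tuple R) :
  rv (insert i (x, t)) = rv (insert i (0, t)) + x *: delta_mx 0 i.
Proof.
apply/rowP => j; rewrite !mxE; case: (unliftP i j) => [k|] ->.
  by rewrite !tnth_insert_lift eq_sym (negbTE (neq_lift _ _)) andbF mulr0 addr0.
by rewrite !tnth_insert_eq !eqxx mulr1 add0r.
Qed.

(** After insertion of the [i]-th coordinate, Fubini makes it the inner variable. The formula on the
    line asks for three integrabilities, which hold for almost every choice of the other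
    coordinates. *)
Lemma gam_integration_by_parts m (i : 'I_m) (f f' : 'rV[R]_m -> R) :
  (forall (p : 'rV[R]_m) (x : R),
     is_derive x 1 (fun y : R => f (p + y *: delta_mx 0 i)) (f' (p + x *: delta_mx 0 i))) ->
  (forall p : 'rV[R]_m, continuous (fun y : R => f' (p + y *: delta_mx 0 i))) ->
  Rintegrable (gam m) (f \o @rv m) -> Rintegrable (gam m) (f' \o @rv m) ->
  Rintegrable (gam m) (fun t => tnth t i * f (rv t)) ->
  \int[gam m]_t f' (rv t) = \int[gam m]_t (tnth t i * f (rv t)).
Proof.
case: m i f f' => [[]//|m] i f f' df cf' fi f'i xfi.
have mf := Rintegrable_measurable fi.
have mf' := Rintegrable_measurable f'i.
have mxf := Rintegrable_measurable xfi.
have mi := @measurable_insert R m i.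
have iw := @insert_wave R m i.
have [+ _] := Rintegrable_gaussian_law mi iw mf => /(_ fi) {}fi.
have [+ _] := Rintegrable_gaussian_law mi iw mf' => /(_ f'i) {}f'i.
have [+ _] := Rintegrable_gaussian_law mi iw mxf => /(_ xfi) {}xfi.
rewrite -(Rintegral_gaussian_law mi iw mf') -(Rintegral_gaussian_law mi iw mxf).
rewrite (Rintegral_fubini2 f'i) (Rintegral_fubini2 xfi).
congr fine; apply: ae_eq_integral => //.
- by apply/measurable_EFinP; apply: (measurable_Rintegral_section2 f'i).
- by apply/measurable_EFinP; apply: (measurable_Rintegral_section2 xfi).
have := ae_integrable2 xfi; have := ae_integrable2 f'i; have := ae_integrable2 fi.
apply: filterS3 => t fti f'ti xfti _; congr EFin.
have E (h : 'rV[R]_m.+1 -> R) : (fun y => h (rv (insert i (y, t)))) =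
    (fun y => h (rv (insert i (0, t)) + y *: delta_mx 0 i)).
  by apply/funext => y; rewrite rv_insert.
transitivity (\int[gauss1]_x (x * f (rv (insert i (x, t))))); last first.
  by apply: eq_Rintegral => x _; rewrite tnth_insert_eq.
apply: (@gauss1_integration_by_parts _ (fun x => f (rv (insert i (x, t))))
  (fun x => f' (rv (insert i (x, t))))) => //.
- by move=> x; rewrite rv_insert E; exact: df.
- by rewrite E; exact: cf'.
- rewrite (_ : (fun x => x * _) =
      (fun x => tnth (insert i (x, t)) i * f (rv (insert i (x, t)))))//.
  by apply/funext => x; rewrite tnth_insert_eq.
Qed.

End gauss_int_gam.

(** * Square-integrable functions *)

Section square_integrable.
Context d (T : measurableType d) (R : realType) (P : probability T R).

Definition L2 (f : T -> R) :=
  measurable_fun setT f /\ Rintegrable P (fun t => f t ^+ 2).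

Lemma L2M f h : L2 f -> L2 h -> Rintegrable P (fun t => f t * h t).
Proof.
move=> [mf fi] [mh hi]; apply: Rintegrable_le (RintegrableD fi hi) _.
  exact: measurable_funM.
by move=> t; rewrite ler_norml; have := sqr_ge0 (f t - h t); have := sqr_ge0 (f t + h t); nra.
Qed.

Lemma L2_cst k : L2 (fun=> k).
Proof. by split => //; exact: finite_measure_integrable_cst. Qed.

Lemma L2_integrable f : L2 f -> Rintegrable P f.
Proof.
move=> lf; have := L2M lf (L2_cst 1).
by rewrite (_ : (fun t => f t * 1) = f)//; apply/funext => t; rewrite mulr1.
Qed.

Lemma L2D f h : L2 f -> L2 h -> L2 (fun t => f t + h t).
Proof.
move=> lf lh; have [mf fi] := lf; have [mh hi] := lh.
split; first exact: measurable_funD.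
rewrite (_ : (fun t => _) = (fun t => f t ^+ 2 + h t ^+ 2 + 2 * (f t * h t))).
  by apply: RintegrableD; [exact: RintegrableD|apply: RintegrableZl; exact: L2M].
by apply/funext => t; ring.
Qed.

Lemma L2Z k f : L2 f -> L2 (fun t => k * f t).
Proof.
move=> [mf fi]; split; first exact: measurable_funM.
rewrite (_ : (fun t => _) = (fun t => k ^+ 2 * f t ^+ 2)); first exact: RintegrableZl.
by apply/funext => t; ring.
Qed.

Lemma L2B f h : L2 f -> L2 h -> L2 (fun t => f t - h t).
Proof.
move=> lf lh; have := L2D lf (L2Z (- 1) lh).
by rewrite (_ : (fun t => f t + - 1 * h t) = (fun t => f t - h t))//;
  apply/funext => t; rewrite mulN1r.
Qed.

Lemma L2_le (f h : T -> R) : measurable_fun setT f -> L2 h -> (forall t, `|f t| <= `|h t|) -> L2 f.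
Proof.
move=> mf [mh hi] fh; split => //; apply: Rintegrable_le hi _; first exact: measurable_funX.
by move=> t; rewrite normrX -[h t ^+ 2]ger0_norm ?sqr_ge0// normrX lerXn2r ?nnegrE.
Qed.

Lemma L2_bounded (f : T -> R) M : measurable_fun setT f -> (forall t, `|f t| <= M) -> L2 f.
Proof.
move=> mf fM; apply: (L2_le mf (L2_cst M)) => t.
exact: le_trans (fM t) (ler_norm _).
Qed.

(** Weighted Young, [|p q| <= p^2 / (2 a) + a q^2 / 2], does the work of Cauchy-Schwarz: a small
    weight [a] settles the term in [h], and then a large [n] settles the term in [f_ n - f]. *)
Lemma L2_cvg_inner (f_ : nat -> T -> R) f h :
  (forall n, L2 (f_ n)) -> L2 f -> L2 h ->
  (fun n => \int[P]_t (f_ n t - f t) ^+ 2) @ \oo --> (0 : R) ->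
  (fun n => \int[P]_t (f_ n t * h t)) @ \oo --> \int[P]_t (f t * h t).
Proof.
move=> lf_ lf lh c0; apply/cvgrPdist_le => e e0.
pose K := \int[P]_t h t ^+ 2.
have K0 : 0 <= K by apply: Rintegral_ge0 => t _; exact: sqr_ge0.
(* This weight gives [a K / 2 <= e / 2], and a squared distance of at most [a e] makes the other
   term at most [e / 2]. The summand 1 keeps the denominator positive when [K = 0]. *)
pose a := e / (K + 1).
have a0 : 0 < a by rewrite divr_gt0// ltr_wpDl.
have a20 : 0 < 2 * a by rewrite mulr_gt0.
move/cvgrPdist_le : c0 => /(_ (a * e) (mulr_gt0 a0 e0)); apply: filterS => n.
rewrite sub0r normrN => h1.
have lB := L2B (lf_ n) lf.
rewrite distrC -RintegralB//; [|exact: L2M|exact: L2M].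
have iq : Rintegrable P (fun t => (f_ n t - f t) ^+ 2 / (2 * a) + a / 2 * h t ^+ 2).
  apply: RintegrableD; last by apply: RintegrableZl; case: lh.
  by under eq_fun do rewrite mulrC; apply: RintegrableZl; case: lB.
have ip : Rintegrable P (fun t => f_ n t * h t - f t * h t).
  by apply: RintegrableB; exact: L2M.
apply: le_trans (le_normr_Rintegral _ ip) _ => //.
have B t : `|f_ n t * h t - f t * h t| <= (f_ n t - f t) ^+ 2 / (2 * a) + a / 2 * h t ^+ 2.
  rewrite -mulrBl; move: (f_ n t - f t) (h t) => p q.
  have -> : p ^+ 2 / (2 * a) + a / 2 * q ^+ 2 = (p ^+ 2 + (a * q) ^+ 2) / (2 * a).
    by field; rewrite gt_eqF.
  rewrite ler_norml lerNl !ler_pdivlMr//.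
  by have := sqr_ge0 (p - a * q); have := sqr_ge0 (p + a * q); nra.
apply: le_trans (le_Rintegral _ (integrable_norm ip) iq (fun t _ => B t)) _ => //.
rewrite RintegralD//; last 2 first.
- by under eq_fun do rewrite mulrC; apply: RintegrableZl; case: lB.
- by apply: RintegrableZl; case: lh.
rewrite RintegralZr//; last by case: lB.
rewrite RintegralZl//; last by case: lh.
have h2 : \int[P]_t (f_ n t - f t) ^+ 2 / (2 * a) <= e / 2.
  by rewrite ler_pdivrMr//; apply: le_trans (ler_norm _) (le_trans h1 _); lra.
have h3 : a / 2 * K <= e / 2.
  rewrite /a mulrAC ler_wpM2r// mulrAC ler_pdivrMr ?ltr_wpDl//; nra.
rewrite -/K; lra.
Qed.

End square_integrable.

(** * The weak Euler-Lagrange equation *)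

Section smooth_waves.
Variables (R : realType) (m : nat).
Implicit Types (k : 'I_m -> R) (b x : R) (p v : 'rV[R]_m) (f h : 'rV[R]_m -> R).

(** The two difference quotients are the same function. The equivalence links directional
    derivatives on row vectors with the one-variable calculus used along coordinate lines. *)
Lemma is_derive_line f p v x l :
  is_derive x 1 (fun y : R => f (p + y *: v)) l <-> is_derive (p + x *: v) v f l.
Proof.
have E : (fun h : R => h^-1 *: (((fun y : R => f (p + y *: v)) \o shift x) (h *: 1) -
      f (p + x *: v))) =
    (fun h : R => h^-1 *: ((f \o shift (p + x *: v)) (h *: v) - f (p + x *: v))).
  apply/funext => h /=; congr (_ *: (f _ - _)).
  by rewrite -[h *: 1]/(h * 1) mulr1 scalerDl addrCA.
by split=> -[d e]; apply: DeriveDef; move: d e; rewrite /derivable /derive E.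
Qed.

Definition dot k p := \sum_i k i * p 0 i.

Lemma dotD k p v : dot k (p + v) = dot k p + dot k v.
Proof. by rewrite /dot -big_split/=; apply: eq_bigr => i _; rewrite mxE mulrDr. Qed.

Lemma dotZ k x v : dot k (x *: v) = x * dot k v.
Proof. by rewrite /dot mulr_sumr; apply: eq_bigr => i _; rewrite mxE mulrCA. Qed.

Lemma dot_delta k i : dot k (delta_mx 0 i) = k i.
Proof.
rewrite /dot (bigD1 i)//= mxE !eqxx mulr1 big1 ?addr0// => j /negbTE ji.
by rewrite mxE ji andbF mulr0.
Qed.

Lemma dot_rv k (t : m.-tuple R) : dot k (rv t) = \sum_i k i * tnth t i.
Proof. by apply: eq_bigr => i _; rewrite mxE. Qed.

Lemma continuous_dot k : continuous (dot k).
Proof.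
rewrite /dot; move: (index_enum _) => s.
elim: s => [|i s IH].
  by under eq_fun do rewrite big_nil; exact: cst_continuous.
under eq_fun do rewrite big_cons.
move=> p; apply: (@continuousD R R^o _ (fun p : 'rV[R]_m => k i * p 0 i)); last exact: IH.
by apply: continuousM; [exact: cst_continuous|exact: coord_continuous].
Qed.

Definition wave k b p := cos (dot k p + b).

Lemma continuous_wave k b : continuous (wave k b).
Proof.
move=> p; apply: (@continuous_comp _ _ _ (fun p => dot k p + b) cos); last exact: continuous_cos.
by apply: (@continuousD R R^o _ (dot k)); [exact: continuous_dot|exact: cst_continuous].
Qed.

(* Shifting the phase by [pi / 2] is differentiation, as [cos (y + pi / 2) = - sin y]. *)
Lemma is_derive_wave k b p v :
  is_derive p v (wave k b) (dot k v * wave k (b + pi / 2) p).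
Proof.
have := @is_derive_line (wave k b) p v 0 (dot k v * wave k (b + pi / 2) p).
rewrite scale0r addr0 => -[+ _]; apply.
rewrite (_ : (fun y => _) = cos \o (fun y : R => y * dot k v + (dot k p + b))); last first.
  by apply/funext => y /=; rewrite /wave dotD dotZ; congr cos; ring.
have D2 : is_derive (0 : R) 1 (fun y : R => y * dot k v + (dot k p + b)) (dot k v).
  by apply: is_derive_eq; rewrite /GRing.scale/=; ring.
have := @is_derive1_comp _ cos _ 0 _ _ (is_derive_cos _) D2.
by rewrite mul0r add0r /wave addrA cosDpihalf mulrC.
Qed.

(** Smoothness concerns all iterated directional derivatives; scaled waves are stable under each of
    them, which reduces it to an induction. *)
Lemma iter_deriv_wave k vs c b : exists c' b',
  iter_deriv vs (fun p => c * wave k b p) = (fun p => c' * wave k b' p).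
Proof.
elim: vs => [|v vs [c' [b' IH]]] /=; first by exists c, b.
exists (c' * dot k v), (b' + pi / 2); rewrite [X in 'D_v X]IH; apply/funext => p.
have D := is_derive_wave k b' p v.
rewrite (_ : (fun p => c' * wave k b' p) = c' \*: wave k b')//.
by rewrite deriveZ// derive_val /GRing.scale/= mulrA.
Qed.

Lemma smooth_wave k c b : smooth (fun p => c * wave k b p).
Proof.
move=> vs; have [c' [b' ->]] := iter_deriv_wave k vs c b.
split=> [p|v p].
  by apply: continuousM; [exact: cst_continuous|exact: continuous_wave].
have D := is_derive_wave k b' p v.
rewrite (_ : (fun p => c' * wave k b' p) = c' \*: wave k b')//.
Qed.

Lemma smoothD f h : smooth f -> smooth h -> smooth (fun p => f p + h p).
Proof.
move=> sf sh.
have E vs : iter_deriv vs (fun p => f p + h p) =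
    (fun p => iter_deriv vs f p + iter_deriv vs h p).
  elim: vs => [//|v vs IH] /=; rewrite [X in 'D_v X]IH; apply/funext => p.
  by rewrite (deriveD ((sf vs).2 v p) ((sh vs).2 v p)).
move=> vs; rewrite E; split=> [p|v p].
  by apply: (@continuousD R R^o); [exact: (sf vs).1|exact: (sh vs).1].
exact: (derivableD ((sf vs).2 v p) ((sh vs).2 v p)).
Qed.

Lemma smooth_is_derive f p v : smooth f -> is_derive p v f ('D_v f p).
Proof. by move=> sf; apply: DeriveDef => //; exact: (sf [::]).2. Qed.

End smooth_waves.

Section weak_equation.
Variables (R : realType) (m : nat).
Local Notation P := (@gam R m).
Implicit Types (f u g : 'rV[R]_m -> R) (k : 'I_m -> R) (b : R).

Lemma gauss_int_sqr f : rV_measurable f ->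
  gauss_int (fun x => (f x ^+ 2)%:E) = (\int[P]_t (f (rv t) ^+ 2)%:E)%E.
Proof.
move=> mf; rewrite gauss_int_gam//; last by move=> x; rewrite lee_fin sqr_ge0.
by apply/measurable_EFinP; exact: measurable_funX.
Qed.

Lemma L2gP f : L2g f <-> L2 P (f \o @rv R m).
Proof.
split=> [[mf fi]|[mf /integrableP[_ fi]]].
  split => //; apply/integrableP; split.
    by apply/measurable_EFinP; exact: measurable_funX.
  move: fi; rewrite gauss_int_sqr//; apply: le_lt_trans.
  rewrite le_eqVlt; apply/orP; left; apply/eqP; apply: eq_integral => t _ /=.
  by rewrite ger0_norm// sqr_ge0.
split=> //; rewrite gauss_int_sqr//; move: fi; apply: le_lt_trans.
rewrite le_eqVlt; apply/orP; left; apply/eqP; apply: eq_integral => t _ /=.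
by rewrite ger0_norm// sqr_ge0.
Qed.

Lemma gauss_int_fin (h : 'rV[R]_m -> R) : (forall x, 0 <= h x) ->
  Rintegrable P (h \o @rv R m) ->
  gauss_int (fun x => (h x)%:E) = (\int[P]_t h (rv t))%:E.
Proof.
move=> h0 hi; have mh := Rintegrable_measurable hi.
rewrite gauss_int_gam//; last exact/measurable_EFinP.
by rewrite /Rintegral fineK//; exact: integrable_fin_num hi.
Qed.

Lemma L2_wave k b : L2 P (wave k b \o @rv R m).
Proof.
apply: (@L2_bounded _ _ _ _ _ 1) => [|t]; last by rewrite /= /wave ler_norml cos_geN1 cos_le1.
rewrite (_ : _ \o _ = (fun t : m.-tuple R => cos (\sum_i k i * tnth t i + b))).
  apply: measurableT_comp (measurable_affine_tuple k b).
  by apply: continuous_measurable_fun; exact: continuous_cos.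
by apply/funext => t /=; rewrite /wave dot_rv.
Qed.

Lemma L2_tnth i : L2 P (fun t => tnth t i).
Proof.
split; first exact: measurable_tnth.
case: m i => [[]//|m'] i.
have mx : measurable_fun setT (fun t : m'.+1.-tuple R => tnth t i ^+ 2).
  by apply: measurable_funX; exact: measurable_tnth.
apply/(Rintegrable_gaussian_law (@measurable_insert R m' i) (@insert_wave R m' i) mx).
under eq_fun do rewrite tnth_insert_eq.
apply/integrable21ltyP.
  apply/measurable_EFinP; apply: measurable_funX; exact: measurable_fst.
under eq_integral do under eq_integral do rewrite /=.
have /integrableP[_ h] := @gauss1_sqr_integrable R.
have PT : @gam R m' setT = 1%E by exact: probability_setT.
by rewrite integral_cst//= PT mule1.
Qed.

Lemma L2_tnth_wave i k c b : L2 P (fun t => tnth t i * (c * wave k b (rv t))).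
Proof.
have lx := L2Z c (L2_tnth i); have [mw _] := L2Z c (L2_wave k b).
apply: (L2_le _ lx).
  by apply: measurable_funM => //; exact: measurable_tnth.
move=> t; rewrite mulrCA !normrM ler_wpM2l// -[leRHS]mulr1 ler_wpM2l//.
by rewrite /wave ler_norml cos_geN1 cos_le1.
Qed.

(** For the wave [w] of phase [b], the factor [k i * wave k (b + pi / 2)] is the partial derivative
    [d_i w], and [d_i^2 w = - k_i^2 w]. The bracket on the right is thus [- d_i^2 w + x_i d_i w],
    the [i]-th part of [- L w], and the identity is integration by parts for the product
    [q = f d_i w]. *)
Lemma smooth_wave_parts (f : 'rV[R]_m -> R) k b i :
  smooth f -> L2g f -> L2g (fun p => 'D_(delta_mx 0 i) f p) ->
  \int[P]_t ('D_(delta_mx 0 i) f (rv t) * (k i * wave k (b + pi / 2) (rv t))) =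
  \int[P]_t (f (rv t) * (k i ^+ 2 * wave k b (rv t) +
                         tnth t i * (k i * wave k (b + pi / 2) (rv t)))).
Proof.
move=> sf /L2gP lf /L2gP ldf.
set e := delta_mx 0 i : 'rV[R]_m.
pose q p := f p * (k i * wave k (b + pi / 2) p).
pose q' p := 'D_e f p * (k i * wave k (b + pi / 2) p) - f p * (k i ^+ 2 * wave k b p).
have lw c c' : L2 P (fun t => c * wave k c' (rv t)) by exact: L2Z (L2_wave k c').
have i1 : Rintegrable P (fun t => 'D_e f (rv t) * (k i * wave k (b + pi / 2) (rv t))).
  exact: L2M ldf (lw _ _).
have i2 : Rintegrable P (fun t => f (rv t) * (k i ^+ 2 * wave k b (rv t))).
  exact: L2M lf (lw _ _).
have lxw := L2_tnth_wave i k (k i) (b + pi / 2).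
have i3 : Rintegrable P (fun t => f (rv t) * (tnth t i * (k i * wave k (b + pi / 2) (rv t)))).
  exact: L2M lf lxw.
have ibp : \int[P]_t q' (rv t) = \int[P]_t (tnth t i * q (rv t)).
  apply: gam_integration_by_parts.
  - move=> p x; apply/is_derive_line.
    move: (p + x *: e) => z; have D1 := smooth_is_derive z e sf.
    have D2 := is_derive_wave k (b + pi / 2) z e.
    rewrite (_ : q = f * (k i \*: wave k (b + pi / 2)))//.
    apply: is_derive_eq; rewrite /q' /e dot_delta -/e.
    rewrite (_ : wave k (b + pi / 2 + pi / 2) z = - wave k b z).
      have -> : (k i \*: wave k (b + pi / 2)) z = k i * wave k (b + pi / 2) z by [].
      rewrite /GRing.scale/=; ring.
    by rewrite /wave !addrA !cosDpihalf sinDpihalf.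
  - move=> p; have cl : continuous (fun y : R => p + y *: e).
      move=> y; apply: cvgD; first exact: cvg_cst.
      by apply: cvgZ; [exact: cvg_id|exact: cvg_cst].
    have cq : continuous q'.
      have cw c c' : continuous (fun p : 'rV[R]_m => c * wave k c' p).
        by move=> y; apply: continuousM; [exact: cst_continuous|exact: continuous_wave].
      move=> y; apply: (@continuousB R R^o _
        (fun p : 'rV[R]_m => 'D_e f p * (k i * wave k (b + pi / 2) p))
        (fun p : 'rV[R]_m => f p * (k i ^+ 2 * wave k b p)));
        apply: continuousM; try exact: cw.
      + exact: (sf [:: e]).1.
      + exact: (sf [::]).1.
    by move=> y; apply: (@continuous_comp _ _ _ (fun y : R => p + y *: e) q'); [exact: cl|exact: cq].
  - exact: L2M lf (lw _ _).
  - exact: RintegrableB.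
  - rewrite (_ : (fun t => _) =
      (fun t => f (rv t) * (tnth t i * (k i * wave k (b + pi / 2) (rv t)))))//.
    by apply/funext => t; rewrite /q mulrCA.
under [RHS]eq_Rintegral do rewrite mulrDr.
rewrite RintegralD//.
have -> : \int[P]_t (f (rv t) * (tnth t i * (k i * wave k (b + pi / 2) (rv t)))) =
    \int[P]_t (tnth t i * q (rv t)).
  by apply: eq_Rintegral => t _; rewrite /q mulrCA.
by rewrite -ibp /q' RintegralB// [RHS]addrC subrK.
Qed.

End weak_equation.

(** * The closed gradient and the first variation of the energy *)

Section sobolev.
Variables (R : realType) (m : nat).
Local Notation P := (@gam R m).
Implicit Types (u v g : 'rV[R]_m -> R) (G H : 'rV[R]_m -> 'rV[R]_m).
Implicit Types (k : 'I_m -> R) (b : R).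

Lemma Rintegrable_sum n (F : 'I_n -> m.-tuple R -> R) :
  (forall i, Rintegrable P (F i)) -> Rintegrable P (fun t => \sum_i F i t).
Proof.
move=> Fi; move: (index_enum _) => s; elim: s => [|i s IH].
  by under eq_fun do rewrite big_nil; exact: finite_measure_integrable_cst.
by under eq_fun do rewrite big_cons; exact: RintegrableD.
Qed.

Lemma Rintegral_sum n (F : 'I_n -> m.-tuple R -> R) :
  (forall i, Rintegrable P (F i)) ->
  \int[P]_t (\sum_i F i t) = \sum_i \int[P]_t F i t.
Proof.
move=> Fi; move: (index_enum _) => s.
suff [] : Rintegrable P (fun t => \sum_(i <- s) F i t) /\
  \int[P]_t (\sum_(i <- s) F i t) = \sum_(i <- s) \int[P]_t F i t by [].
elim: s => [|i s [IHi IH]].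
  rewrite big_nil; under eq_fun do rewrite big_nil.
  by split; [exact: finite_measure_integrable_cst|rewrite Rintegral_prob_cst].
rewrite big_cons -IH; under eq_fun do rewrite big_cons.
by split; [exact: RintegrableD|rewrite RintegralD].
Qed.

Lemma dist2E u v : L2g u -> L2g v ->
  dist2 u v = (\int[P]_t (u (rv t) - v (rv t)) ^+ 2)%:E.
Proof.
move=> /L2gP lu /L2gP lv; rewrite /dist2 (@gauss_int_fin _ _ (fun x => (u x - v x) ^+ 2))//.
  by move=> x; exact: sqr_ge0.
by case: (L2B lu lv).
Qed.

Lemma dist2VE G H : L2gV G -> L2gV H ->
  dist2V G H = (\int[P]_t (\sum_i (G (rv t) 0 i - H (rv t) 0 i) ^+ 2))%:E.
Proof.
move=> lG lH.
rewrite /dist2V (@gauss_int_fin _ _ (fun x => \sum_i (G x 0 i - H x 0 i) ^+ 2))//.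
  by move=> x; apply: sumr_ge0 => i _; exact: sqr_ge0.
apply: Rintegrable_sum => i.
have /L2gP lGi := lG i; have /L2gP lHi := lH i.
by case: (L2B lGi lHi).
Qed.

(** Each side is a pairing with a fixed square-integrable function, so the identity for the smooth
    approximants passes to the limit in the graph norm. *)
Lemma H1g_wave_parts u G k b i : H1g u G ->
  \int[P]_t (G (rv t) 0 i * (k i * wave k (b + pi / 2) (rv t))) =
  \int[P]_t (u (rv t) * (k i ^+ 2 * wave k b (rv t) +
                         tnth t i * (k i * wave k (b + pi / 2) (rv t)))).
Proof.
move=> [lu [lG [phi [sphi [cphi cgrad]]]]].
have lw c c' : L2 P (fun t => c * wave k c' (rv t)) by exact: L2Z (L2_wave k c').
have lxw := L2_tnth_wave i k (k i) (b + pi / 2).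
have gradE n x j : grad (phi n) x 0 j = 'D_(delta_mx 0 j) (phi n) x by rewrite mxE.
have lphi n : L2g (phi n) by have [_ []] := sphi n.
have lgrad n : L2gV (grad (phi n)) by have [_ []] := sphi n.
have lD n : L2g (fun p => 'D_(delta_mx 0 i) (phi n) p).
  by have := lgrad n i; under eq_fun do rewrite gradE.
have c1 : (fun n => \int[P]_t (phi n (rv t) - u (rv t)) ^+ 2) @ \oo --> (0 : R).
  have E : (fun n => \int[P]_t (phi n (rv t) - u (rv t)) ^+ 2) =
      fine \o (fun n => dist2 (phi n) u).
    by apply/funext => n; rewrite /= dist2E.
  by rewrite E; exact: fine_cvg cphi.
have c2 : (fun n => \int[P]_t (\sum_j (grad (phi n) (rv t) 0 j - G (rv t) 0 j) ^+ 2)) @ \oo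
    --> (0 : R).
  have E : (fun n => \int[P]_t (\sum_j (grad (phi n) (rv t) 0 j - G (rv t) 0 j) ^+ 2)) =
      fine \o (fun n => dist2V (grad (phi n)) G).
    by apply/funext => n; rewrite /= dist2VE.
  by rewrite E; exact: fine_cvg cgrad.
have c3 : (fun n => \int[P]_t ('D_(delta_mx 0 i) (phi n) (rv t) - G (rv t) 0 i) ^+ 2) @ \oo
    --> (0 : R).
  apply: squeeze_cvgr (cvg_cst 0) c2; apply: nearW => n; apply/andP; split.
    by apply: Rintegral_ge0 => t _; exact: sqr_ge0.
  have di j : Rintegrable P (fun t => (grad (phi n) (rv t) 0 j - G (rv t) 0 j) ^+ 2).
    have /L2gP l1 := lgrad n j; have /L2gP l2 := lG j.
    by case: (L2B l1 l2).
  apply: le_Rintegral => //.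
  - by have := di i; under eq_fun do rewrite gradE.
  - exact: Rintegrable_sum.
  - move=> t _; rewrite (bigD1 i)//= gradE lerDl.
    by apply: sumr_ge0 => j _; exact: sqr_ge0.
have L1 := L2_cvg_inner (fun n => (L2gP _).1 (lphi n)) ((L2gP _).1 lu)
  (L2D (lw (k i ^+ 2) b) lxw) c1.
have L3 := L2_cvg_inner (fun n => (L2gP _).1 (lD n)) ((L2gP _).1 (lG i))
  (lw (k i) (b + pi / 2)) c3.
have E : (fun n => \int[P]_t ('D_(delta_mx 0 i) (phi n) (rv t) * (k i * wave k (b + pi / 2) (rv t)))) =
    fun n => \int[P]_t (phi n (rv t) * (k i ^+ 2 * wave k b (rv t) +
      tnth t i * (k i * wave k (b + pi / 2) (rv t)))).
  by apply/funext => n; exact: (smooth_wave_parts k b (sphi n).1 (lphi n) (lD n)).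
by rewrite /= E in L3; exact: (cvg_unique _ L3 L1).
Qed.

Definition energy2 g u G := \int[P]_t ((\sum_i G (rv t) 0 i ^+ 2) / 2) +
  \int[P]_t ((u (rv t) - g (rv t)) ^+ 2 / 2).

Lemma energyE g u G : L2g g -> L2g u -> L2gV G -> energy g u G = (energy2 g u G)%:E.
Proof.
move=> /L2gP lg /L2gP lu lG; rewrite /energy /energy2 EFinD.
rewrite (@gauss_int_fin _ _ (fun x => (\sum_i G x 0 i ^+ 2) / 2)); last 2 first.
- by move=> x; rewrite divr_ge0//; apply: sumr_ge0 => i _; exact: sqr_ge0.
- rewrite /comp; under eq_fun do rewrite mulrC; apply: RintegrableZl; apply: Rintegrable_sum => i.
  by have /L2gP[] := lG i.
rewrite (@gauss_int_fin _ _ (fun x => (u x - g x) ^+ 2 / 2))//.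
- by move=> x; rewrite divr_ge0// sqr_ge0.
- rewrite /comp; under eq_fun do rewrite mulrC; apply: RintegrableZl.
  by case: (L2B lu lg).
Qed.

Definition wave_grad k b : 'rV[R]_m -> 'rV[R]_m :=
  fun x => \row_i (k i * wave k (b + pi / 2) x).

Lemma L2g_wave c k b : L2g (fun x => c * wave k b x).
Proof. by apply/L2gP; exact: L2Z (L2_wave k b). Qed.

Lemma L2gD u v : L2g u -> L2g v -> L2g (fun x => u x + v x).
Proof. by move=> /L2gP lu /L2gP lv; apply/L2gP; exact: L2D. Qed.

Lemma grad_wave c k b (f : 'rV[R]_m -> R) x : smooth f ->
  grad (fun x => f x + c * wave k b x) x = grad f x + c *: wave_grad k b x.
Proof.
move=> sf; apply/rowP => i; rewrite !mxE.
have D1 := smooth_is_derive x (delta_mx 0 i) sf.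
have D2 := smooth_is_derive x (delta_mx 0 i) (smooth_wave k c b).
rewrite (@deriveD _ _ _ f (fun x => c * wave k b x)); [|by case: D1|by case: D2].
have D3 := is_derive_wave k b x (delta_mx 0 i).
rewrite (_ : (fun x => c * wave k b x) = c \*: wave k b)// deriveZ; last by case: D3.
by rewrite (@derive_val _ _ _ _ _ _ _ D3) dot_delta.
Qed.

(** Adding the same smooth wave to every approximant leaves both distances unchanged, so [u] can be
    varied along a wave inside the domain of the closure. *)
Lemma H1g_add_wave u G c k b : H1g u G ->
  H1g (fun x => u x + c * wave k b x) (fun x => G x + c *: wave_grad k b x).
Proof.
move=> [lu [lG [phi [sphi [cphi cgrad]]]]].
have gE (F : 'rV[R]_m -> 'rV[R]_m) i : (fun x => (F x + c *: wave_grad k b x) 0 i) =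
    (fun x => F x 0 i + (c * k i) * wave k (b + pi / 2) x).
  by apply/funext => x; rewrite !mxE mulrA.
split; first by apply: L2gD => //; exact: L2g_wave.
split; first by move=> i; rewrite gE; apply: L2gD; [exact: lG|exact: L2g_wave].
exists (fun n x => phi n x + c * wave k b x); split; [|split].
- move=> n; have [s1 [s2 s3]] := sphi n; split; [|split].
  + by apply: smoothD => //; exact: smooth_wave.
  + by apply: L2gD => //; exact: L2g_wave.
  + move=> i; rewrite (_ : (fun x => _) =
      (fun x => (grad (phi n) x + c *: wave_grad k b x) 0 i)).
      by rewrite gE; apply: L2gD; [exact: s3|exact: L2g_wave].
    by apply/funext => x; rewrite grad_wave.
- rewrite (_ : (fun n => _) = (fun n => dist2 (phi n) u))//.
  apply/funext => n; congr gauss_int; apply/funext => x; congr ((_ ^+ 2)%:E); ring.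
- rewrite (_ : (fun n => _) = (fun n => dist2V (grad (phi n)) G))//.
  apply/funext => n; congr gauss_int; apply/funext => x; congr (_%:E).
  apply: eq_bigr => i _; rewrite grad_wave; last by have [] := sphi n.
  rewrite !mxE; congr (_ ^+ 2); ring.
Qed.

Lemma quadratic_min0 (B C : R) : (forall c, 0 <= c * B + c ^+ 2 * C) -> B = 0.
Proof.
move=> h; apply/eqP; apply/negPn/negP => B0.
pose K := `|C| + 1; have K0 : 0 < K by rewrite ltr_wpDl.
have CK : C < K by rewrite /K ltr_pwDr// ler_norm.
(* At this point the polynomial equals [- B^2 (K - C) / K^2], which is negative when [B != 0]: the
   choice [K = |C| + 1] ensures [C < K] and [0 < K] whatever the sign of [C]. *)
have := h (- B / K).
rewrite (_ : _ + _ = - (B ^+ 2 / K ^+ 2 * (K - C))); last by field; rewrite gt_eqF.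
have B2 : 0 < B ^+ 2 by rewrite exprn_even_gt0.
have K2 : 0 < K ^+ 2 by rewrite exprn_gt0.
by rewrite oppr_ge0 leNgt mulr_gt0 ?subr_gt0// divr_gt0.
Qed.

(** Adding [c] times the wave to [u] changes the energy by a quadratic polynomial in [c] without
    constant term. Minimality makes it nonnegative for every [c], so its linear coefficient, the
    left-hand side, vanishes. *)
Lemma minimizer_variation g u G k b : L2g g -> H1g u G ->
  (forall v H, H1g v H -> (energy g u G <= energy g v H)%E) ->
  \sum_i \int[P]_t (G (rv t) 0 i * (k i * wave k (b + pi / 2) (rv t))) +
  \int[P]_t ((u (rv t) - g (rv t)) * wave k b (rv t)) = 0.
Proof.
move=> lg hu hmin; have [lu [lG _]] := hu.
have /L2gP lg' := lg; have /L2gP lu' := lu.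
have lw c c' : L2 P (fun t => c * wave k c' (rv t)) by exact: L2Z (L2_wave k c').
have lG' i : L2 P (fun t => G (rv t) 0 i) by have /L2gP := lG i.
set w := wave k b; set w' := wave k (b + pi / 2).
pose C := \int[P]_t ((\sum_i (k i * w' (rv t)) ^+ 2) / 2) + \int[P]_t (w (rv t) ^+ 2 / 2).
apply: (@quadratic_min0 _ C) => c.
have := hmin _ _ (H1g_add_wave c k b hu).
have [lv [lH _]] := H1g_add_wave c k b hu.
rewrite !energyE// lee_fin -subr_ge0; congr (0 <= _).
have halfI f : Rintegrable P f -> Rintegrable P (fun t => f t / 2).
  by move=> fi; under eq_fun do rewrite mulrC; exact: RintegrableZl.
have iG i : Rintegrable P (fun t => G (rv t) 0 i ^+ 2) by case: (lG' i).
have iw i : Rintegrable P (fun t => (k i * w' (rv t)) ^+ 2) by case: (lw (k i) (b + pi / 2)).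
have iGw i : Rintegrable P (fun t => G (rv t) 0 i * (k i * w' (rv t))) by exact: L2M (lG' i) (lw _ _).
have E1 : \int[P]_t ((\sum_i (G (rv t) + c *: wave_grad k b (rv t)) 0 i ^+ 2) / 2) =
    \int[P]_t ((\sum_i G (rv t) 0 i ^+ 2) / 2) +
    (c * \sum_i \int[P]_t (G (rv t) 0 i * (k i * w' (rv t))) +
     c ^+ 2 * \int[P]_t ((\sum_i (k i * w' (rv t)) ^+ 2) / 2)).
  have h1 := halfI _ (Rintegrable_sum iG).
  have h2 := Rintegrable_sum iGw.
  have h3 := halfI _ (Rintegrable_sum iw).
  have h4 := RintegrableZl c h2; have h5 := RintegrableZl (c ^+ 2) h3.
  rewrite -Rintegral_sum// -(RintegralZl c _ h2)// -(RintegralZl (c ^+ 2) _ h3)//.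
  rewrite -(RintegralD _ h4 h5)// -(RintegralD _ h1 (RintegrableD h4 h5))//.
  apply: eq_Rintegral => t _; rewrite !mulr_suml !mulr_sumr -!big_split/=.
  by apply: eq_bigr => i _; rewrite !mxE -/w'; field.
have lB := L2B lu' lg'.
have i0 : Rintegrable P (fun t => (u (rv t) - g (rv t)) ^+ 2) by case: lB.
have i1 : Rintegrable P (fun t => (u (rv t) - g (rv t)) * w (rv t)).
  exact: L2M lB (L2_wave k b).
have i2 : Rintegrable P (fun t => w (rv t) ^+ 2) by case: (L2_wave k b).
have E2 : \int[P]_t ((u (rv t) + c * w (rv t) - g (rv t)) ^+ 2 / 2) =
    \int[P]_t ((u (rv t) - g (rv t)) ^+ 2 / 2) +
    (c * \int[P]_t ((u (rv t) - g (rv t)) * w (rv t)) +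
     c ^+ 2 * \int[P]_t (w (rv t) ^+ 2 / 2)).
  have h1 := halfI _ i0; have h2 := RintegrableZl c i1.
  have h3 := halfI _ i2; have h4 := RintegrableZl (c ^+ 2) h3.
  rewrite -(RintegralZl c _ i1)// -(RintegralZl (c ^+ 2) _ h3)//.
  rewrite -(RintegralD _ h2 h4)// -(RintegralD _ h1 (RintegrableD h2 h4))//.
  by apply: eq_Rintegral => t _; field.
rewrite /energy2 E1 E2 /C; ring.
Qed.

(** Integration by parts has moved the whole gradient onto the wave [w]. The bracket is [w - L w],
    because [L w = - |k|^2 w - (k . x) w'] with [w'] the wave of phase [b + pi / 2]. *)
Lemma minimizer_weak g u G k b : L2g g -> H1g u G ->
  (forall v H, H1g v H -> (energy g u G <= energy g v H)%E) ->
  \int[P]_t (u (rv t) * ((1 + \sum_i k i ^+ 2) * wave k b (rv t) +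
                         dot k (rv t) * wave k (b + pi / 2) (rv t))) =
  \int[P]_t (g (rv t) * wave k b (rv t)).
Proof.
move=> lg hu hmin; have := minimizer_variation k b lg hu hmin.
have [lu _] := hu; have /L2gP lg' := lg; have /L2gP lu' := lu.
under eq_bigr do rewrite (H1g_wave_parts k b _ hu).
have lw c c' : L2 P (fun t => c * wave k c' (rv t)) by exact: L2Z (L2_wave k c').
have i1 i : Rintegrable P (fun t => u (rv t) * (k i ^+ 2 * wave k b (rv t) +
    tnth t i * (k i * wave k (b + pi / 2) (rv t)))).
  by apply: L2M lu' _; exact: L2D (lw _ _) (L2_tnth_wave _ _ _ _).
have iu : Rintegrable P (fun t => u (rv t) * wave k b (rv t)) by exact: L2M lu' (L2_wave k b).
have ig : Rintegrable P (fun t => g (rv t) * wave k b (rv t)) by exact: L2M lg' (L2_wave k b).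
rewrite -Rintegral_sum//; under [X in _ + X]eq_Rintegral do rewrite mulrBl.
rewrite RintegralB// addrA => /eqP; rewrite subr_eq0 => /eqP <-.
rewrite -RintegralD//; last exact: Rintegrable_sum.
apply: eq_Rintegral => t _; rewrite -mulr_sumr big_split/= -mulr_suml dot_rv.
under [in RHS]eq_bigr do rewrite mulrCA mulrA.
by rewrite -mulr_suml; ring.
Qed.

Lemma L2_dot k : L2 P (fun t => dot k (rv t)).
Proof.
rewrite /dot; move: (index_enum _) => s; elim: s => [|i s IH].
  by under eq_fun do rewrite big_nil; exact: L2_cst.
under eq_fun do rewrite big_cons mxE.
by apply: L2D; [exact: (L2Z (k i) (L2_tnth R i))|exact: IH].
Qed.

Lemma L2_dot_wave k b : L2 P (fun t => dot k (rv t) * wave k b (rv t)).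
Proof.
have lx := L2_dot k; have [mx _] := lx; have [mw _] := L2_wave k b.
apply: (L2_le _ lx); first exact: measurable_funM.
move=> t; rewrite normrM -[leRHS]mulr1 ler_wpM2l//.
by rewrite /wave ler_norml cos_geN1 cos_le1.
Qed.

Lemma minimizer_mode g u G (a : 'I_m -> R) b : L2g g -> H1g u G ->
  (forall v H, H1g v H -> (energy g u G <= energy g v H)%E) ->
  let A := \sum_i a i ^+ 2 in
  \int[P]_t (u (rv t) * mode A b 1 (dot a (rv t))) =
  \int[unif01]_s \int[P]_t (g (rv t) * mode A b (clip s) (dot a (rv t))).
Proof.
move=> lg hu hmin A; have [/L2gP lu _] := hu; have /L2gP lg' := lg.
have A0 : 0 <= A by apply: sumr_ge0 => i _; exact: sqr_ge0.
(* [F] is a primitive of [f] in [s] with [F 0 = 0] and [F 1 = E_1]; the factor [s] accounts for the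
   term 1 in [1 - L]. *)
pose F s y := s * mode A b s y.
pose f s y := mode A b s y + s * dmode A b s y.
have mdot : measurable_fun setT (fun t : m.-tuple R => dot a (rv t)).
  have := measurable_affine_tuple a 0; congr measurable_fun; apply/funext => t.
  by rewrite dot_rv addr0.
have ldot := L2_dot a.
have E1 : \int[P]_t ((u \o @rv R m) t * (F 1 (dot a (rv t)) - F 0 (dot a (rv t)))) =
    \int[P]_t (u (rv t) * mode A b 1 (dot a (rv t))).
  by apply: eq_Rintegral => t _; rewrite /F mul0r subr0 mul1r.
rewrite -E1.
transitivity (\int[unif01]_s \int[P]_t ((u \o @rv R m) t * f (clip s) (dot a (rv t)))); last first.
  apply: eq_Rintegral => s _; set z := clip s.
  have := minimizer_weak (fun i => z * a i) b lg hu hmin.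
  have dE t : dot (fun i => z * a i) (rv t) = z * dot a (rv t).
    by rewrite /dot mulr_sumr; apply: eq_bigr => i _; rewrite mulrA.
  have sE : \sum_i (z * a i) ^+ 2 = z ^+ 2 * A.
    by rewrite /A mulr_sumr; apply: eq_bigr => i _; rewrite exprMn.
  (* The weak equation at frequency [z a] is rescaled by the factor that normalizes [mode]. *)
  move=> /(congr1 (fun x => expR (z ^+ 2 * A / 2) * x)).
  rewrite -!RintegralZl//; last 2 first.
  - exact: L2M lg' (L2_wave _ _).
  - by apply: L2M lu _; apply: L2D; [exact: L2Z (L2_wave _ _)|exact: L2_dot_wave].
  rewrite sE => e; transitivity (\int[P]_t (expR (z ^+ 2 * A / 2) *
      (u (rv t) * ((1 + z ^+ 2 * A) * wave (fun i => z * a i) b (rv t) +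
        dot (fun i => z * a i) (rv t) * wave (fun i => z * a i) (b + pi / 2) (rv t))))).
    apply: eq_Rintegral => t _.
    rewrite /f /mode /dmode /wave dE addrA cosDpihalf /=; ring.
  by rewrite e; apply: eq_Rintegral => t _; rewrite /mode /wave dE mulrCA.
apply: (@Rintegral_FTC_exchange _ _ _ _ _ _ _ _ (expR (A / 2) * (A + 2))).
- exact: L2_integrable.
- exact: L2M.
- exact: mdot.
- apply: measurable_funD; first exact: measurable_mode.
  by apply: measurable_funM; [exact: measurable_fst|exact: measurable_dmode].
- move=> s y s01; have [b1 b2] := mode_bounds b y A0 s01.
  have /andP[s0 s1] := s01.
  apply: le_trans (ler_normD _ _) _; rewrite [`|s * _|]normrM (ger0_norm s0).
  have e0 := expR_ge0 (A / 2).
  have : s * `|dmode A b s y| <= expR (A / 2) * (A + `|y|).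
    by apply: le_trans b2; rewrite ler_piMl.
  have := normr_ge0 y; move: (expR _) e0 b1 => E e0 b1 y0 b3.
  rewrite -mulrA; apply: (@le_trans _ _ (E * (1 + (A + `|y|)))).
    by rewrite mulrDr mulr1; exact: lerD.
  rewrite ler_wpM2l//; nra.
- move=> y s; have D := is_derive_mode A b y s.
  rewrite (_ : F ^~ y = id * (mode A b ^~ y))//.
  by apply: is_derive_eq; rewrite /GRing.scale/= /f; ring.
- move=> y s; apply: cvgD; first exact: continuous_mode.
  by apply: cvgM; [exact: cvg_id|exact: continuous_dmode].
Qed.

End sobolev.

(** * The resolvent *)

Section density_measure.
Context d (T : measurableType d) (R : realType) (mu : {finite_measure set T -> \bar R}).
Variable f : T -> R.
Hypothesis (f0 : forall t, 0 <= f t) (fi : Rintegrable mu f).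

(** The proofs of positivity and integrability are arguments so that the structure of a finite
    measure can be attached to the constant itself. *)
Definition density_measure of (forall t, 0 <= f t) & Rintegrable mu f :=
  fun A : set T => (\int[mu]_(t in A) (f t)%:E)%E.

Local Notation nu := (density_measure f0 fi).

Let f0' t : (0 <= (f t)%:E)%E. Proof. by rewrite lee_fin. Qed.
Let nu0 : nu set0 = 0%E. Proof. exact: integral_set0. Qed.
Let nu_ge0 A : (0 <= nu A)%E. Proof. exact: integral_ge0. Qed.
Let nu_sigma_additive : semi_sigma_additive nu.
Proof. exact: semi_sigma_additive_nng_induced (measurable_int _ fi) f0'. Qed.

HB.instance Definition _ := isMeasure.Build _ _ _ nu nu0 nu_ge0 nu_sigma_additive.

Let nu_fin : fin_num_fun nu.
Proof. by move=> A mA; apply: integrable_fin_num => //; exact: integrableS fi. Qed.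

HB.instance Definition _ := @Measure_isFinite.Build _ _ _ nu nu_fin.

Lemma ge0_integral_density (h : T -> \bar R) : measurable_fun setT h ->
  (forall t, 0 <= h t)%E ->
  (\int[nu]_t h t = \int[mu]_t (h t * (f t)%:E))%E.
Proof.
move=> mh h0.
have dom : nu `<< mu.
  apply/null_content_dominatesP => A mA A0; rewrite /density_measure.
  by apply: null_set_integral => //; exact: measurable_funTS (measurable_int _ fi).
rewrite -(@Radon_Nikodym_SigmaFinite.change_of_variables _ _ _ nu mu dom h setT h0)//.
have mr : measurable_fun setT (Radon_Nikodym_SigmaFinite.f nu mu).
  by apply: measurable_int; apply: Radon_Nikodym_SigmaFinite.f_integrable.
have mf : measurable_fun setT (EFin \o f) by exact: measurable_int fi.
have ae : ae_eq mu setT (Radon_Nikodym_SigmaFinite.f nu mu) (EFin \o f).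
  apply: integral_ae_eq => //.
    exact: Radon_Nikodym_SigmaFinite.f_integrable.
  by move=> A _ mA; rewrite -Radon_Nikodym_SigmaFinite.f_integral.
apply: ae_eq_integral => //; try exact: emeasurable_funM.
by apply: filterS ae => x /= + _ => ->.
Qed.

Lemma Rintegral_density (h : T -> R) : measurable_fun setT h ->
  \int[nu]_t h t = \int[mu]_t (h t * f t).
Proof.
move=> mh; rewrite /Rintegral; congr fine; rewrite integralE [RHS]integralE.
have mF : measurable_fun setT (EFin \o h) by exact/measurable_EFinP.
rewrite (ge0_integral_density (measurable_funepos mF) (funepos_ge0 _)).
rewrite (ge0_integral_density (measurable_funeneg mF) (funeneg_ge0 _)).
congr (_ - _)%E; apply: eq_integral => x _.
  by rewrite !funeposE /= maxe_pMl ?mul0e ?lee_fin.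
by rewrite !funenegE /= maxe_pMl ?mul0e ?lee_fin// -EFinM mulNr.
Qed.

End density_measure.

Section injectivity.
Variables (R : realType) (m : nat) (P : {finite_measure set (m.-tuple R) -> \bar R}).

(* The finite measures of densities [D^+] and [D^-] have the same Fourier transform. *)
Lemma wave_orthogonal_ae0 (D : m.-tuple R -> R) : Rintegrable P D ->
  (forall (a : 'I_m -> R) b, \int[P]_t (D t * cos (\sum_i a i * tnth t i + b)) = 0) ->
  {ae P, forall t, D t = 0}.
Proof.
move=> Di orth; have mD := Rintegrable_measurable Di.
pose Dp t := Num.max (D t) 0; pose Dn t := Num.max (- D t) 0.
have Dp0 t : 0 <= Dp t by rewrite le_max lexx orbT.
have Dn0 t : 0 <= Dn t by rewrite le_max lexx orbT.
have DE t : D t = Dp t - Dn t.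
  by rewrite /Dp /Dn; case: (leP (D t) 0); case: (leP (- D t) 0); lra.
have Dpi : Rintegrable P Dp.
  apply: (Rintegrable_le _ (integrable_norm Di)) => [|t]; first exact: measurable_maxr.
  by rewrite ger0_norm// /Dp ge_max ler_norm normr_ge0.
have Dni : Rintegrable P Dn.
  apply: (Rintegrable_le _ (integrable_norm Di)) => [|t].
    by apply: measurable_maxr => //; exact: measurableT_comp.
  rewrite ger0_norm// /Dn ge_max normr_ge0 andbT.
  by apply: le_trans (ler_norm _) _; rewrite normrN.
pose mup : {finite_measure set _ -> \bar R} := density_measure Dp0 Dpi.
pose mun : {finite_measure set _ -> \bar R} := density_measure Dn0 Dni.
have E A : measurable A -> mup A = mun A.
  apply: eq_measure_tuple => a b; rewrite /osc.
  have mc : measurable_fun setT (fun t : m.-tuple R => cos (\sum_i a i * tnth t i + b)).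
    apply: measurableT_comp (measurable_affine_tuple a b).
    by apply: continuous_measurable_fun; exact: continuous_cos.
  have bc t : `|cos (\sum_i a i * tnth t i + b)| <= 1 by rewrite ler_norml cos_geN1 cos_le1.
  rewrite !Rintegral_density//; apply/eqP; rewrite -subr_eq0 -RintegralB//.
  - apply/eqP; apply: etrans (orth a b); apply: eq_Rintegral => t _.
    by rewrite -mulrBr -DE mulrC.
  - by under eq_fun do rewrite mulrC; exact: Rintegrable_bddM Dpi mc bc.
  - by under eq_fun do rewrite mulrC; exact: Rintegrable_bddM Dni mc bc.
have part A : measurable A -> (\int[P]_(t in A) (Dp t)%:E = \int[P]_(t in A) (Dn t)%:E)%E.
  exact: E.
have := @integral_ae_eq _ _ _ P setT measurableT (EFin \o Dn) (EFin \o Dp) Dpi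
  (measurable_int _ Dni) (fun A _ mA => part A mA).
by apply: filterS => t /(_ I) [e]; rewrite DE e subrr.
Qed.

End injectivity.

Section resolvent.
Variables (R : realType) (m : nat).
Local Notation P := (@gam R m).
Local Notation Q := ((unif01 \x @gam R m)%E : probability (R * m.-tuple R)%type R).

(** Computed from [clip s], so that the two coefficients of Mehler's kernel have squares of sum 1
    for every real [s]. *)
Definition csq (s : R) : R := Num.sqrt (1 - clip s ^+ 2).

Lemma clip_csq s : clip s ^+ 2 + csq s ^+ 2 = 1.
Proof.
have /andP[c0 c1] := clip_bounds s.
by rewrite sqr_sqrtr ?subr_ge0 ?exprn_ile1// addrC subrK.
Qed.

Lemma measurable_csq : measurable_fun setT csq.
Proof.
apply: measurableT_comp; first by apply: continuous_measurable_fun; exact: sqrt_continuous.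
by apply: measurable_funB => //; apply: measurable_funX; exact: measurable_clip.
Qed.

Definition mehler (x : m.-tuple R) (z : R * m.-tuple R) : m.-tuple R :=
  lincomb (clip z.1) (csq z.1) x z.2.

Lemma measurable_mehler : measurable_fun [set: m.-tuple R * (R * m.-tuple R)]
  (fun w => mehler w.1 w.2).
Proof.
apply/measurable_fun_tnthP => i.
rewrite (_ : _ \o _ = (fun w : m.-tuple R * (R * m.-tuple R) =>
    clip w.2.1 * tnth w.1 i + csq w.2.1 * tnth w.2.2 i)); last first.
  by apply/funext => w /=; rewrite tnth_mktuple.
have m21 : measurable_fun [set: m.-tuple R * (R * m.-tuple R)] (fun w => w.2.1).
  exact: (measurableT_comp measurable_fst measurable_snd).
have m22 : measurable_fun [set: m.-tuple R * (R * m.-tuple R)] (fun w => w.2.2).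
  exact: (measurableT_comp measurable_snd measurable_snd).
have m1 := measurableT_comp (@measurable_clip R) m21.
have m2 := measurableT_comp (measurable_tnth i) (@measurable_fst _ _ (m.-tuple R) (R * m.-tuple R)%type).
have m3 := measurableT_comp measurable_csq m21.
have m4 := measurableT_comp (measurable_tnth i) m22.
exact: (measurable_funD (measurable_funM m1 m2) (measurable_funM m3 m4)).
Qed.

(** Tonelli brings [s] outermost. For fixed [s] the combination of two independent Gaussian vectors
    is again Gaussian, so the inner integral is constant in [s], and [unif01] has mass 1. *)
Lemma ge0_integral_mehler (f : m.-tuple R -> \bar R) : measurable_fun setT f ->
  (forall t, 0 <= f t)%E ->
  (\int[P]_x \int[Q]_z f (mehler x z) = \int[P]_x f x)%E.
Proof.
move=> mf f0.
have mK : measurable_fun [set: m.-tuple R * (R * m.-tuple R)]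
  (fun w => f (mehler w.1 w.2)) by exact: (measurableT_comp mf measurable_mehler).
have := @fubini_tonelli _ _ _ _ _ P Q (fun w => f (mehler w.1 w.2)) mK (fun _ => f0 _).
rewrite /fubini_F /fubini_G /= => ->.
have mG : measurable_fun setT (fun z => \int[P]_x f (mehler x z))%E.
  exact: (measurable_fun_fubini_tonelli_G (m1 := P) (fun w => f (mehler w.1 w.2)) mK (fun _ => f0 _)).
rewrite (@fubini_tonelli1 _ _ _ _ _ unif01 P (fun z => \int[P]_x f (mehler x z))%E mG); last first.
  by move=> z; exact: integral_ge0.
rewrite /fubini_F.
transitivity (\int[unif01]_(s in [set: R]) \int[P]_x f x)%E; last first.
  rewrite integral_cst// [X in (_ * X)%E](_ : _ = 1%E) ?mule1//.
  exact: probability_setT.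
apply: eq_integral => s _.
have mL := measurableT_comp mf (measurable_lincomb (m := m) (clip s) (csq s)).
have := @fubini_tonelli2 _ _ _ _ _ P P (fun z => f (lincomb (clip s) (csq s) z.1 z.2)) mL (fun _ => f0 _).
rewrite /fubini_G /mehler /= => <-.
exact: (ge0_integral_gaussian_law (measurable_lincomb (clip s) (csq s))
  (lincomb_wave (clip_csq s)) mf f0).
Qed.

Lemma Rintegrable_mehler (f : m.-tuple R -> R) : Rintegrable P f ->
  Rintegrable (P \x Q)%E (fun w => f (mehler w.1 w.2)).
Proof.
move=> fi; have mf := Rintegrable_measurable fi.
apply/integrable12ltyP.
  by apply/measurable_EFinP; exact: (measurableT_comp mf measurable_mehler).
move/integrableP : fi => [_]; rewrite -ge0_integral_mehler//.
by apply/measurable_EFinP; exact: measurableT_comp.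
Qed.

Definition resolvent (f : m.-tuple R -> R) (x : m.-tuple R) : R :=
  \int[Q]_z f (mehler x z).

Lemma Rintegrable_resolvent f : Rintegrable P f -> Rintegrable P (resolvent f).
Proof. by move=> fi; exact: (Rintegrable_section1 (Rintegrable_mehler fi)). Qed.

End resolvent.

Section resolvent_mode.
Variables (R : realType) (m : nat).
Local Notation P := (@gam R m).
Local Notation Q := ((unif01 \x @gam R m)%E : probability (R * m.-tuple R)%type R).
Variables (a : 'I_m -> R) (b : R).
Let A := \sum_i a i ^+ 2.
Let E s (x : m.-tuple R) := mode A b s (dot a (rv x)).

Let measurable_E s : measurable_fun setT (E s).
Proof.
have md : measurable_fun setT (fun t : m.-tuple R => dot a (rv t)) by case: (L2_dot a).
exact: (measurableT_comp (measurable_fun_pair2 (f := fun z => mode A b z.1 z.2) s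
  (measurable_mode A b)) md).
Qed.

Let E_bound s x : 0 <= s <= 1 -> `|E s x| <= expR (A / 2).
Proof.
move=> s01; have A0 : 0 <= A by apply: sumr_ge0 => i _; exact: sqr_ge0.
by have [] := mode_bounds b (dot a (rv x)) A0 s01.
Qed.

(** Averaging over [y] produces the factor [exp (- c^2 A / 2)], and [c^2 = 1 - s^2] turns the
    normalization of [E_1] into that of [E_s]. This is why the waves carry their exponential
    factor. *)
Lemma mode_lincomb s c (x : m.-tuple R) : s ^+ 2 + c ^+ 2 = 1 ->
  \int[P]_y mode A b 1 (dot a (rv (lincomb s c x y))) = mode A b s (dot a (rv x)).
Proof.
move=> sc1; rewrite /mode expr1n mul1r.
have wE (y : m.-tuple R) : cos (1 * dot a (rv (lincomb s c x y)) + b) =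
    cos (\sum_i (c * a i) * tnth y i + (s * dot a (rv x) + b)).
  congr cos; rewrite mul1r !dot_rv mulr_sumr addrA -big_split/=; congr (_ + b).
  by apply: eq_bigr => i _; rewrite tnth_mktuple; ring.
transitivity (\int[P]_y (expR (A / 2) *
    cos (\sum_i (c * a i) * tnth y i + (s * dot a (rv x) + b)))).
  by apply: eq_Rintegral => y _; rewrite wE.
rewrite RintegralZl//; last by apply: cos_bounded_integrable; exact: measurable_affine_tuple.
rewrite gam_wave mulrA -expRD; congr (expR _ * _).
have -> : \sum_i (c * a i) ^+ 2 = c ^+ 2 * A.
  by rewrite mulr_sumr; apply: eq_bigr => i _; rewrite exprMn.
rewrite (_ : c ^+ 2 = 1 - s ^+ 2); last by rewrite -sc1 addrAC subrr add0r.
by field.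
Qed.

Lemma resolvent_mode (f : m.-tuple R -> R) : Rintegrable P f ->
  \int[P]_x (resolvent f x * mode A b 1 (dot a (rv x))) =
  \int[unif01]_s \int[P]_x (f x * mode A b (clip s) (dot a (rv x))).
Proof.
move=> fi; have mf := Rintegrable_measurable fi.
have i01 : 0 <= (1 : R) <= 1 by rewrite ler01 lexx.
have ki := Rintegrable_mehler fi.
have mE1 := measurableT_comp (measurable_E 1)
  (@measurable_fst _ _ (m.-tuple R) (R * m.-tuple R)%type).
have Ki : Rintegrable (P \x Q)%E (fun w => f (mehler w.1 w.2) * E 1 w.1).
  exact: (Rintegrable_bddM ki mE1 (fun w => E_bound w.1 i01)).
(* The factor [E 1 x] enters the inner integral only where that section is integrable, hence for
   almost every [x]. *)
transitivity (\int[P]_x \int[Q]_z (f (mehler x z) * E 1 x)).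
  apply: ae_eq_Rintegral.
  - exact: (measurable_funM (measurable_Rintegral_section1 ki) (measurable_E 1)).
  - exact: (measurable_Rintegral_section1 Ki).
  - have := ae_integrable1 ki; apply: filterS => x xi.
    by rewrite /resolvent -RintegralZr.
rewrite -(Rintegral_fubini1 Ki) (Rintegral_fubini2 Ki).
rewrite (Rintegral_fubini1 (Rintegrable_section2 Ki)).
apply: eq_Rintegral => s _ /=.
set c := csq s; set r := clip s.
have rc : r ^+ 2 + c ^+ 2 = 1 := clip_csq s.
have li : Rintegrable (P \x P)%E (fun z => f (lincomb r c z.1 z.2)).
  exact: ((Rintegrable_gaussian_law (measurable_lincomb r c) (lincomb_wave rc) mf).1 fi).
have Li : Rintegrable (P \x P)%E (fun z => f (lincomb r c z.1 z.2) * E 1 z.1).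
  apply: (Rintegrable_bddM li (M := expR (A / 2))) => [|z]; last exact: E_bound.
  exact: (measurableT_comp (measurable_E 1) measurable_fst).
rewrite -(Rintegral_fubini2 Li).
have mF : measurable_fun setT (fun z : m.-tuple R * m.-tuple R => f z.2 * E 1 z.1).
  apply: measurable_funM; first exact: (measurableT_comp mf measurable_snd).
  exact: (measurableT_comp (measurable_E 1) measurable_fst).
(* Exchangeability trades [f (r x + c y) E_1 x] for [f x E_1 (r x + c y)]: this is the symmetry of
   [P_s]. *)
rewrite (Rintegral_exchangeable rc mF) /=.
have fi1 : Rintegrable (P \x P)%E (fun z => f z.1).
  apply/integrable12ltyP.
    by apply/measurable_EFinP; exact: (measurableT_comp mf measurable_fst).
  have /integrableP[_] := fi; apply: le_lt_trans; rewrite le_eqVlt; apply/orP; left; apply/eqP.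
  apply: eq_integral => x _; rewrite -[RHS]mule1.
  rewrite (integral_cst P measurableT `|(f x)%:E|%E) [X in (_ * X)%E](_ : _ = 1%E)//.
  exact: probability_setT.
have Mi : Rintegrable (P \x P)%E (fun z => f z.1 * E 1 (lincomb r c z.1 z.2)).
  apply: (Rintegrable_bddM fi1 (M := expR (A / 2))) => [|z]; last exact: E_bound.
  exact: (measurableT_comp (measurable_E 1) (measurable_lincomb r c)).
rewrite (Rintegral_fubini1 Mi).
apply: eq_Rintegral => x _; rewrite -(mode_lincomb x rc) -RintegralZl//.
apply: (@bounded_Rintegrable _ _ _ _ _ (expR (A / 2))) => [|y]; last exact: E_bound.
exact: (measurableT_comp (measurable_E 1) (measurable_fun_pair2 x (measurable_lincomb r c))).
Qed.

End resolvent_mode.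

Lemma minimizer_resolvent (R : realType) (m : nat) (g u : 'rV[R]_m -> R)
    (G : 'rV[R]_m -> 'rV[R]_m) : L2g g -> H1g u G ->
  (forall v H, H1g v H -> (energy g u G <= energy g v H)%E) ->
  {ae @gam R m, forall t, u (rv t) = resolvent (g \o @rv R m) t}.
Proof.
move=> lg hu hmin; have [/L2gP lu _] := hu; have /L2gP lg' := lg.
have ui := L2_integrable lu; have gi := L2_integrable lg'.
have ri := Rintegrable_resolvent gi.
have Di := RintegrableB ui ri.
suff : {ae @gam R m, forall t, u (rv t) - resolvent (g \o @rv R m) t = 0}.
  by apply: filterS => t /eqP; rewrite subr_eq0 => /eqP.
apply: wave_orthogonal_ae0 => // a b.
pose A := \sum_i a i ^+ 2.
have := minimizer_mode a b lg hu hmin; rewrite -/A => e1.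
have := resolvent_mode a b gi; rewrite -/A -e1 => e2.
have mc := measurable_affine_tuple a b.
have mw : measurable_fun setT (fun t : m.-tuple R => cos (\sum_i a i * tnth t i + b)).
  by apply: measurableT_comp mc; apply: continuous_measurable_fun; exact: continuous_cos.
have bw (t : m.-tuple R) : `|cos (\sum_i a i * tnth t i + b)| <= 1.
  by rewrite ler_norml cos_geN1 cos_le1.
have E h : Rintegrable (@gam R m) h -> \int[@gam R m]_t (h t * mode A b 1 (dot a (rv t))) =
    expR (A / 2) * \int[@gam R m]_t (h t * cos (\sum_i a i * tnth t i + b)).
  move=> hi; rewrite -RintegralZl//; last exact: Rintegrable_bddM hi mw bw.
  by apply: eq_Rintegral => t _; rewrite /mode expr1n !mul1r dot_rv mulrCA.
move: e2; rewrite !E//.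
move/(mulfI (lt0r_neq0 (expR_gt0 _))) => e2.
under eq_Rintegral do rewrite mulrBl.
rewrite RintegralB//; [|exact: Rintegrable_bddM ui mw bw|exact: Rintegrable_bddM ri mw bw].
by rewrite e2 subrr.
Qed.

(** * Convexity of the resolvent *)

Section positive_boxes.
Variable R : realType.

Lemma gauss1_gt0 (A : set R) (a : R) : measurable A -> `[a, a + 1]%classic `<=` A ->
  (0 < gauss1 A)%E.
Proof.
(* Since [r] bounds [|x|] on [[a, a + 1]] and the density decreases in [|x|], its value [e] at [r]
   is a lower bound there. *)
move=> mA aA; pose r := `|a| + 1; pose e := normal_pdf (0 : R) 1 r.
have e0 : 0 < e.
  by rewrite /e normal_pdfE ?oner_neq0// mulr_gt0 ?normal_peak_gt0 ?oner_neq0// expR_gt0.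
have mpdf : measurable_fun setT (fun x : R => (normal_pdf 0 1 x)%:E).
  by apply/measurable_EFinP; exact: measurable_normal_pdf.
rewrite /gauss1 /normal_prob.
apply: (@lt_le_trans _ _ (\int[lebesgue_measure]_(x in `[a, (a + 1)%R]) e%:E)%E).
  rewrite integral_cst//= lebesgue_measure_itv/= lte_fin ltrDl ltr01.
  by rewrite -EFinB addrAC subrr add0r mule1 lte_fin.
apply: (@le_trans _ _ (\int[lebesgue_measure]_(x in `[a, (a + 1)%R]) (normal_pdf 0 1 x)%:E)%E).
  apply: ge0_le_integral => //.
  - by move=> x _; rewrite lee_fin ltW.
  - exact: measurable_funTS.
  - move=> x; rewrite /= in_itv/= => /andP[ax xa]; rewrite lee_fin.
    rewrite /e !normal_pdfE ?oner_neq0// ler_wpM2l ?normal_peak_ge0//.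
    rewrite /normal_fun !subr0 ler_expR ler_wpM2r ?invr_ge0 ?mulrn_wge0 ?sqr_ge0//.
    rewrite lerN2 -[x ^+ 2]ger0_norm ?sqr_ge0// normrX lerXn2r ?nnegrE ?addr_ge0//.
    have h1 : - a <= `|a| by rewrite -normrN ler_norm.
    have := ler_norm a; rewrite /r ler_norml; lra.
apply: ge0_subset_integral => //; first exact: measurable_funTS.
by move=> x _; rewrite lee_fin normal_pdf_ge0.
Qed.

Definition box m (A : 'I_m -> set R) : set (m.-tuple R) := [set t | forall i, A i (tnth t i)].

Lemma measurable_box m (A : 'I_m -> set R) : (forall i, measurable (A i)) ->
  measurable (box A).
Proof.
move=> mA; rewrite (_ : box A = \bigcap_(i : 'I_m) ((fun t => tnth t i) @^-1` A i)).
  apply: fin_bigcap_measurable => // i _; rewrite -[X in measurable X]setTI.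
  exact: (measurable_tnth i).
by apply/seteqP; split => t h i => [_|]; [exact: h|exact: (h i I)].
Qed.

Lemma gam_box_gt0 m (A : 'I_m -> set R) : (forall i, measurable (A i)) ->
  (forall i, (0 < gauss1 (A i))%E) -> (0 < gam R m (box A))%E.
Proof.
elim: m A => [|m IH] A mA A0.
  rewrite (_ : box A = setT); first by rewrite probability_setT.
  by apply/seteqP; split => // t _ [n n0].
pose A' i := A (lift ord0 i).
have -> : gam R m.+1 (box A) = ((gauss1 \x gam R m) (A ord0 `*` box A'))%E.
  rewrite /= /distribution /pushforward; congr product_measure1.
  apply/seteqP; split => [[x t] h|[x t] [h1 h2] i] /=.
    split; first by have := h ord0; rewrite /cons_pair/= tnth0.
    by move=> i; have := h (lift ord0 i); rewrite /cons_pair/= tnthS.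
  by case: (unliftP ord0 i) => [j|] ->; rewrite /cons_pair/= ?tnth0 ?tnthS//; exact: h2.
rewrite product_measure1E//; last by apply: measurable_box => i; exact: mA.
rewrite mule_gt0//; first exact: A0.
by apply: IH => i; [exact: mA|exact: A0].
Qed.

End positive_boxes.

Section convex_sets.
Variables (R : realType) (m : nat) (C : 'rV[R]_m -> Prop).
Hypothesis convC : forall p q (s : R), 0 <= s <= 1 -> C p -> C q -> C (s *: p + (1 - s) *: q).

Let side (e : bool) (x y : R) := if e then x < y else y < x.

Let side_comb e x y z (s : R) : 0 <= s <= 1 -> side e x y -> side e x z ->
  side e x (s * y + (1 - s) * z).
Proof.
move=> /andP[s0 s1]; have [->|sn0] := eqVneq s 0; first by rewrite mul0r add0r subr0 mul1r.
have sp : 0 < s by rewrite lt0r sn0.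
have s1' : 0 <= 1 - s by rewrite subr_ge0.
case: e => /= xy xz.
  have h1 : 0 < s * (y - x) by rewrite mulr_gt0// subr_gt0.
  have h2 : 0 <= (1 - s) * (z - x) by rewrite mulr_ge0// subr_ge0 ltW.
  lra.
have h1 : 0 < s * (x - y) by rewrite mulr_gt0// subr_gt0.
have h2 : 0 <= (1 - s) * (x - z) by rewrite mulr_ge0// subr_ge0 ltW.
lra.
Qed.

(* Two points on either side of a coordinate hyperplane through [p] are combined
   into a point on it; doing so for each coordinate in turn yields [p]. *)
Lemma convex_orthants (p : 'rV[R]_m) :
  (forall e : 'I_m -> bool, exists2 q, C q & forall i, side (e i) (p 0 i) (q 0 i)) -> C p.
Proof.
move=> h.
(* After [n] stages the first [n] coordinates agree with [p] and the others lie on prescribed sides.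
   All sign patterns are kept in the induction, since the next stage combines two points whose
   patterns may differ only at coordinate [n]. *)
suff H n : (n <= m)%N -> forall e : 'I_m -> bool, exists2 q, C q &
    forall i : 'I_m, if (i < n)%N then q 0 i = p 0 i else side (e i) (p 0 i) (q 0 i).
  have [q Cq qp] := H m (leqnn _) (fun=> true).
  by rewrite (_ : p = q)//; apply/rowP => i; have := qp i; rewrite ltn_ord.
elim: n => [_|n IH nm] e; first exact: h.
pose j := Ordinal nm.
have [q Cq qp] := IH (ltnW nm) (fun i => if i == j then true else e i).
have [r Cr rp] := IH (ltnW nm) (fun i => if i == j then false else e i).
have qj : p 0 j < q 0 j by have := qp j; rewrite /= ltnn eqxx.
have rj : r 0 j < p 0 j by have := rp j; rewrite /= ltnn eqxx.
pose s := (p 0 j - r 0 j) / (q 0 j - r 0 j).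
have d0 : 0 < q 0 j - r 0 j by lra.
have s01 : 0 <= s <= 1.
  apply/andP; split; first by apply: divr_ge0; lra.
  by rewrite ler_pdivrMr// mul1r; lra.
exists (s *: q + (1 - s) *: r); first exact: convC.
move=> i; rewrite !mxE; have := qp i; have := rp i.
have [->|ij] := eqVneq i j.
  rewrite /= ltnn ltnSn => _ _; rewrite /s; by field; rewrite gt_eqF.
have inn : (i == n :> nat) = false.
  by apply: contraNF ij => /eqP e'; apply/eqP/val_inj.
have -> : (i < n.+1)%N = (i < n)%N by rewrite ltnS leq_eqVlt inn.
case: ifP => _; first by move=> -> ->; ring.
by move=> h1 h2; exact: side_comb.
Qed.

End convex_sets.

Section convex_resolvent.
Variables (R : realType) (m : nat) (g : 'rV[R]_m -> R).
Hypotheses (cg : convex_fun g) (lg : L2g g).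
Local Notation P := (@gam R m).
Local Notation Q := ((unif01 \x @gam R m)%E : probability (R * m.-tuple R)%type R).

Definition tv (p : 'rV[R]_m) : m.-tuple R := [tuple p 0 i | i < m].

Lemma tvK p : rv (tv p) = p.
Proof. by apply/rowP => i; rewrite mxE tnth_mktuple. Qed.

Lemma rv_lincomb s c (x y : m.-tuple R) : rv (lincomb s c x y) = s *: rv x + c *: rv y.
Proof. by apply/rowP => i; rewrite !mxE tnth_mktuple. Qed.

Definition trans (p : 'rV[R]_m) (z : R * m.-tuple R) := clip z.1 *: p + csq z.1 *: rv z.2.

Lemma trans_mehler (t : m.-tuple R) z : trans (rv t) z = rv (mehler t z).
Proof. by rewrite /mehler rv_lincomb. Qed.

Lemma trans_comb p q (s : R) z :
  trans (s *: p + (1 - s) *: q) z = s *: trans p z + (1 - s) *: trans q z.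
Proof. by apply/rowP => i; rewrite !mxE; ring. Qed.

Lemma measurable_trans (h : 'rV[R]_m -> R) p : measurable_fun setT (h \o @rv R m) ->
  measurable_fun setT (fun z => h (trans p z)).
Proof.
move=> mh; rewrite -[p]tvK; under eq_fun do rewrite trans_mehler.
exact: (measurableT_comp mh (measurable_fun_pair2 (tv p) (@measurable_mehler R m))).
Qed.

(** As [k] is nonnegative, the convexity inequality is a domination, so the points of integrability
    form a convex set. Every open orthant with apex [p] has positive Gaussian measure and therefore
    meets this set of full measure. *)
Lemma ae_all_integrable (k : 'rV[R]_m -> R) : (forall x, 0 <= k x) -> convex_fun k ->
  Rintegrable P (k \o @rv R m) -> forall p, Rintegrable Q (fun z => k (trans p z)).
Proof.
move=> k0 ck ki; move=> p; apply: (@convex_orthants R m (fun p => Rintegrable Q (fun z => k (trans p z)))) =>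
  [{}p q s s01 pi_ qi|e].
  have mk := Rintegrable_measurable ki.
  apply: (@Rintegrable_le _ _ _ _ _ (fun z => s * k (trans p z) + (1 - s) * k (trans q z))).
  - exact: measurable_trans.
  - by apply: RintegrableD; exact: RintegrableZl.
  - by move=> z; rewrite ger0_norm// trans_comb; exact: ck.
have [N [mN N0 subN]] := ae_integrable1 (Rintegrable_mehler ki).
pose A (i : 'I_m) : set R := if e i then [set x | p 0 i < x] else [set x | x < p 0 i].
have AE i : A i = if e i then `]p 0 i, +oo[%classic else `]-oo, p 0 i[%classic.
  rewrite /A; case: (e i); apply/seteqP; split => x /=; by rewrite in_itv/= ?andbT.
have mA i : measurable (A i) by rewrite AE; case: (e i); exact: measurable_itv.
have A0 i : (0 < gauss1 (A i))%E.
  case ei : (e i).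
    apply: (@gauss1_gt0 _ _ (p 0 i + 1)) => // x; rewrite /A ei/= in_itv/= => /andP[? ?]; lra.
  apply: (@gauss1_gt0 _ _ (p 0 i - 2)) => // x; rewrite /A ei/= in_itv/= => /andP[? ?]; lra.
have /existsNP[t /not_implyP[tA tN]] : ~ box A `<=` N.
  move=> AN; have := gam_box_gt0 mA A0.
  have : (P (box A) <= P N)%E by apply: le_measure; rewrite ?inE//; exact: measurable_box.
  by rewrite N0 => /le_lt_trans h /h; rewrite ltxx.
exists (rv t).
  have : ~ ~ Rintegrable Q (fun z => k (rv (mehler t z))) by move=> nt; apply: tN; apply: subN.
  by move=> /contrapT; under eq_fun do rewrite -trans_mehler.
by move=> i; have := tA i; rewrite /A mxE; case: (e i).
Qed.

(** A nonnegative convex integrable majorant of [|g|]. Convexity at the midpoint 0 of [x] and [- x]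
    gives [- g x <= g (- x) - 2 g 0], which explains the reflected term and the constant. *)
Let symmetrized x := Num.max (g x) 0 + Num.max (g (- x)) 0 + 2 * `|g 0|.

Let symmetrized_ge0 x : 0 <= symmetrized x.
Proof. by rewrite /symmetrized !addr_ge0 ?mulr_ge0// le_max lexx orbT. Qed.

Let symmetrized_ge x : `|g x| <= symmetrized x.
Proof.
have h : g 0 <= 2^-1 * g x + (1 - 2^-1) * g (- x).
  have := @cg x (- x) 2^-1; rewrite (_ : 2^-1 *: x + _ = 0).
    by apply; lra.
  by apply/rowP => i; rewrite !mxE; field.
have := ler_norm (g 0); have := normr_ge0 (g 0); rewrite /symmetrized.
have : - g 0 <= `|g 0| by rewrite -normrN ler_norm.
rewrite ler_norml; case: (leP (g x) 0); case: (leP (g (- x)) 0); lra.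
Qed.

Let symmetrized_convex : convex_fun symmetrized.
Proof.
move=> x y s s01; have /andP[s0 s1] := s01; rewrite /symmetrized.
have h1 := cg x y s01; have := cg (- x) (- y) s01.
rewrite (_ : s *: - x + (1 - s) *: - y = - (s *: x + (1 - s) *: y)); last first.
  by rewrite !scalerN opprD.
move: h1; move: (g (s *: x + _)) (g (- (s *: x + _))) (g x) (g y) (g (- x)) (g (- y)).
move=> a b c d e f h1 h2.
have M (p q : R) : p <= Num.max p 0 /\ 0 <= Num.max p 0 by rewrite !le_max !lexx orbT.
have m1 : Num.max a 0 <= s * Num.max c 0 + (1 - s) * Num.max d 0.
  have [c1 c2] := M c 0; have [d1 d2] := M d 0; rewrite ge_max; apply/andP; split; nra.
have m2 : Num.max b 0 <= s * Num.max e 0 + (1 - s) * Num.max f 0.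
  have [c1 c2] := M e 0; have [d1 d2] := M f 0; rewrite ge_max; apply/andP; split; nra.
lra.
Qed.

(** Reflection preserves the Gaussian law, whose characteristic function depends on the frequencies
    through their squares; hence [g (- x)] is as integrable as [g x]. *)
Let symmetrized_integrable : Rintegrable P (symmetrized \o @rv R m).
Proof.
have /L2gP lg' := lg; have gi := L2_integrable lg'; have mg := Rintegrable_measurable gi.
pose opp (t : m.-tuple R) : m.-tuple R := [tuple - tnth t i | i < m].
have mopp : measurable_fun setT opp.
  apply/measurable_fun_tnthP => i; rewrite (_ : _ \o _ = (fun t : m.-tuple R => - tnth t i)).
    by apply: measurableT_comp => //; exact: measurable_tnth.
  by apply/funext => t /=; rewrite tnth_mktuple.
have wopp a b : \int[P]_t cos (\sum_i a i * tnth (opp t) i + b) =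
    expR (- (\sum_i a i ^+ 2) / 2) * cos b.
  have <- : \sum_i (- a i) ^+ 2 = \sum_i a i ^+ 2.
    by apply: eq_bigr => i _; rewrite sqrrN.
  rewrite -gam_wave; apply: eq_Rintegral => t _; congr (cos (_ + _)).
  by apply: eq_bigr => i _; rewrite tnth_mktuple mulrN mulNr.
have rvopp t : rv (opp t) = - rv t by apply/rowP => i; rewrite !mxE tnth_mktuple.
have maxi (h : m.-tuple R -> R) : Rintegrable P h -> Rintegrable P (fun t => Num.max (h t) 0).
  move=> hi; have mh := Rintegrable_measurable hi.
  apply: (Rintegrable_le _ (integrable_norm hi)) => [|t]; first exact: measurable_maxr.
  by rewrite ger0_norm ?le_max ?lexx ?orbT// ge_max ler_norm normr_ge0.
apply: RintegrableD; last exact: finite_measure_integrable_cst.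
apply: RintegrableD; first exact: maxi.
apply: (maxi (fun t => g (- rv t))).
have := (Rintegrable_gaussian_law mopp wopp mg).1 gi.
by rewrite /=; under eq_fun do rewrite rvopp.
Qed.

Lemma trans_integrable p : Rintegrable Q (fun z => g (trans p z)).
Proof.
have [mg _] := lg.
apply: (@Rintegrable_le _ _ _ _ _ (fun z => symmetrized (trans p z))).
- exact: measurable_trans.
- exact: ae_all_integrable.
- by move=> z; exact: symmetrized_ge.
Qed.

(** For fixed [z] the point [trans p z] is affine in [p], so the inequality holds under the
    integral. Integrability at each of the three points allows it to be integrated. *)
Lemma convex_resolvent : convex_fun (fun p => \int[Q]_z g (trans p z)).
Proof.
move=> p q s s01.
rewrite -!RintegralZl//; try exact: trans_integrable.
rewrite -RintegralD//; try by apply: RintegrableZl; exact: trans_integrable.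
apply: le_Rintegral => //; first exact: trans_integrable.
  by apply: RintegrableD; apply: RintegrableZl; exact: trans_integrable.
by move=> z _; rewrite trans_comb; exact: cg.
Qed.

End convex_resolvent.

(** Elements of the Sobolev space matter only up to null sets, so convexity is asserted of a
    representative: the resolvent of [g], given by a convergent integral at every point. *)
Theorem theorem3p8 (R : realType) (m : nat) (g : 'rV[R]_m -> R) :
  convex_fun g -> L2g g ->
  forall (u : 'rV[R]_m -> R) (G : 'rV[R]_m -> 'rV[R]_m),
    H1g u G ->
    (forall (v : 'rV[R]_m -> R) (H : 'rV[R]_m -> 'rV[R]_m),
        H1g v H -> (energy g u G <= energy g v H)%E) ->
    exists w : 'rV[R]_m -> R, convex_fun w /\ ae_eq_gauss u w.
Proof.
move=> cg lg u G hu hmin.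
pose w p := \int[(unif01 \x @gam R m)%E]_z g (trans p z).
exists w; split; first exact: convex_resolvent.
have wE t : w (rv t) = resolvent (g \o @rv R m) t.
  by apply: eq_Rintegral => z _; rewrite trans_mehler.
have [[mu _] _] := hu.
have mw : measurable_fun setT (w \o @rv R m).
  have /L2gP lg' := lg; rewrite (_ : _ \o _ = resolvent (g \o @rv R m)).
    exact: Rintegrable_measurable (Rintegrable_resolvent (L2_integrable lg')).
  by apply/funext => t; exact: wE.
pose N := [set t : m.-tuple R | u (rv t) != w (rv t)].
have mN : measurable N.
  rewrite (_ : N = (fun t => u (rv t) - w (rv t)) @^-1` (~` [set 0])).
    rewrite -[X in measurable X]setTI; apply: measurable_funB => //.
    exact: measurableC.
  by apply/seteqP; split => t /=; rewrite /N /= -subr_eq0 => /eqP.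
have N0 : @gam R m N = 0%E.
  apply/negligibleP => //; apply: negligibleS (minimizer_resolvent lg hu hmin) => t /=.
  by rewrite /N /= -wE => /eqP.
rewrite /ae_eq_gauss gauss_int_gam; last 2 first.
- apply/measurable_EFinP.
  rewrite (_ : (fun t => _) = \1_N); first exact: measurable_indic.
  by apply/funext => t; rewrite !indicE.
- by move=> x; rewrite lee_fin.
by rewrite -N0 -[X in _ = @gam R m X]setIT -integral_indic.
Qed.
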